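(* Consider a single-item market with $n\ge1$ buyers whose values are i.i.d. from a distribution $F$ that is both regular and anti-MHR. The social welfare of the Nash Solution is at least $\frac{n-1}{n}\mathrm{Opt}_F$.
   Context: Setting: one seller with a single item of zero cost and $n\ge 1$ buyers with quasi-linear utilities; values i.i.d. from a known distribution $F$ with support $[v_L,v_H]$ or $[v_L,\infty)$, $v_L\ge0$, no atoms except possibly at $v_H$, CDF $F(t)=\Pr[v<t]$ differentiable on the interior of the support with density $f$, and some price in the support maximizing $p(1-F(p))$. $\mathfrak M$: ex-post feasible, Bayesian incentive compatible, interim individually rational, buyer-symmetric direct mechanisms with all payments going to the seller. For $M\in\mathfrak M$: $\Pi_F(M)$ = expected seller revenue, $U_{i,F}(M)$ = buyer $i$'s ex-ante utility, $U_F(M)=\sum_iU_{i,F}(M)$, welfare $\Pi_F(M)+U_F(M)$; $\mathrm{Opt}_F=\mathbb E[\max_iv_i]$. A Nash Solution is a Pareto-optimal $M\in\arg\max_{M'\in\mathfrak M}\Pi_F(M')\prod_iU_{i,F}(M')$. Regular: $v-\frac{1-F(v)}{f(v)}$ nondecreasing; anti-MHR: $\frac{f(v)}{1-F(v)}$ nonincreasing. *)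

(* Defs.v *)
From mathcomp Require Import all_boot all_order all_algebra perm.
From mathcomp Require Import all_classical all_reals all_analysis.
Import Order.TTheory GRing.Theory Num.Theory.

Set Implicit Arguments.
Unset Strict Implicit.
Unset Printing Implicit Defensive.

Local Open Scope classical_set_scope.
Local Open Scope ring_scope.

(* The value distribution F, given as its law mu (a Borel probability  *)
(* on R).  CDF convention of the paper: F(t) = Pr[v < t].              *)
Section Distribution.
Variable R : realType.
Variable mu : probability R R.

Definition cdf (t : R) : R := fine (mu [set x | x < t]).

(* density f = F' (meaningful on the interior of the support) *)
Definition dens (t : R) : R := derive1 cdf t.

Definition supp : set R := [set t : R | forall e : R, 0 < e -> (0 < mu [set x : R | (t - e < x)%R /\ (x < t + e)%R])%E].

(* Standing assumptions; [top] is v_H, with [top = +oo] encoding the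
   unbounded support [v_L, oo). *)
Definition standing_assumptions (vL : R) (top : \bar R) : Prop :=
  [/\ 0 <= vL /\ top != -oo%E,
      supp = [set t | vL <= t /\ (t%:E <= top)%E],
      (forall t : R, t%:E != top -> mu [set t] = 0%E),
      (forall t : R, vL < t -> (t%:E < top)%E -> derivable cdf t 1) &
      (exists p : R, supp p /\ forall q : R, q * (1 - cdf q) <= p * (1 - cdf p))].

Definition virtual_value (v : R) : R := v - (1 - cdf v) / dens v.
Definition hazard (v : R) : R := dens v / (1 - cdf v).

Definition regular (vL : R) (top : \bar R) : Prop :=
  forall s t : R, vL < s -> s <= t -> (t%:E < top)%E ->
    virtual_value s <= virtual_value t.

Definition antiMHR (vL : R) (top : \bar R) : Prop :=
  forall s t : R, vL < s -> s <= t -> (t%:E < top)%E ->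
    hazard t <= hazard s.

End Distribution.

Record mechanism (R : realType) (n : nat) := Mechanism {
  alloc : 'I_n -> ('I_n -> R) -> R;
  pay   : 'I_n -> ('I_n -> R) -> R }.

Definition upd (R : Type) (n : nat) (v : 'I_n -> R) (i : 'I_n) (t : R) : 'I_n -> R :=
  fun j => if j == i then t else v j.

Section Environment.
Variables (R : realType) (d : measure_display) (Omega : measurableType d).
Variable (P : probability Omega R).
Variable (n : nat).
Variable (V : 'I_n -> Omega -> R).
Variable (mu : probability R R).

Local Open Scope ereal_scope.

Definition iid_values : Prop :=
  [/\ (forall i, measurable_fun setT (V i)),
      (forall i (B : set R), measurable B -> P (V i @^-1` B) = mu B) &
      (forall B : 'I_n -> set R, (forall i, measurable (B i)) ->
         P (\bigcap_(i in [set: 'I_n]) (V i @^-1` B i)) =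
         \prod_(i < n) P (V i @^-1` B i))].

Definition prof (w : Omega) : 'I_n -> R := fun j => V j w.

Definition interim_alloc (M : mechanism R n) (i : 'I_n) (t : R) : \bar R :=
  \int[P]_w (alloc M i (upd (prof w) i t))%:E.
Definition interim_pay (M : mechanism R n) (i : 'I_n) (t : R) : \bar R :=
  \int[P]_w (pay M i (upd (prof w) i t))%:E.
Definition interim_util (M : mechanism R n) (i : 'I_n) (t t' : R) : \bar R :=
  t%:E * interim_alloc M i t' - interim_pay M i t'.

Definition well_defined (M : mechanism R n) : Prop :=
  forall i : 'I_n,
    [/\ measurable_fun setT (fun w => alloc M i (prof w)),
        P.-integrable setT (fun w => (pay M i (prof w))%:E),
        (forall t, supp mu t ->
           measurable_fun setT (fun w => alloc M i (upd (prof w) i t))) &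
        (forall t, supp mu t ->
           P.-integrable setT (fun w => (pay M i (upd (prof w) i t))%:E))].

Definition ex_post_feasible (M : mechanism R n) : Prop :=
  forall v : 'I_n -> R, (forall j, supp mu (v j)) ->
    (forall i, (0 <= alloc M i v)%R) /\ (\sum_(i < n) alloc M i v <= 1)%R.

Definition BIC (M : mechanism R n) : Prop :=
  forall i t t', supp mu t -> supp mu t' ->
    interim_util M i t t' <= interim_util M i t t.

Definition interim_IR (M : mechanism R n) : Prop :=
  forall i t, supp mu t -> 0 <= interim_util M i t t.

Definition buyer_symmetric (M : mechanism R n) : Prop :=
  forall (s : {perm 'I_n}) (v : 'I_n -> R) (i : 'I_n),
    alloc M i (fun j => v (s j)) = alloc M (s i) v /\
    pay M i (fun j => v (s j)) = pay M (s i) v.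

Definition in_frakM (M : mechanism R n) : Prop :=
  [/\ well_defined M, ex_post_feasible M, BIC M, interim_IR M &
      buyer_symmetric M].

Definition revenue (M : mechanism R n) : \bar R :=
  \sum_(i < n) \int[P]_w (pay M i (prof w))%:E.

Definition buyer_util (M : mechanism R n) (i : 'I_n) : \bar R :=
  \int[P]_w (V i w * alloc M i (prof w))%:E - \int[P]_w (pay M i (prof w))%:E.

Definition welfare (M : mechanism R n) : \bar R :=
  revenue M + \sum_(i < n) buyer_util M i.

Definition opt : \bar R := \int[P]_w (\big[Num.max/0%R]_(i < n) V i w)%:E.

Definition nash_objective (M : mechanism R n) : \bar R :=
  revenue M * \prod_(i < n) buyer_util M i.

Definition pareto_optimal (M : mechanism R n) : Prop :=
  ~ exists M' : mechanism R n,
      [/\ in_frakM M', revenue M <= revenue M',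
          (forall i, buyer_util M i <= buyer_util M' i) &
          (revenue M < revenue M' \/ exists i, buyer_util M i < buyer_util M' i)].

Definition nash_solution (M : mechanism R n) : Prop :=
  [/\ in_frakM M,
      (forall M', in_frakM M' -> nash_objective M' <= nash_objective M) &
      pareto_optimal M].

End Environment.

(* Main.v *)
Require Import Defs.
From mathcomp Require Import all_boot all_order all_algebra perm.
From mathcomp Require Import all_classical all_reals all_analysis.
From mathcomp Require Import measurable_realfun ring lra.
From mathcomp Require polyrcf.
Import Order.TTheory GRing.Theory Num.Theory.
Import numFieldNormedType.Exports.

(* The mechanism "allocate efficiently, pay every buyer the values of the
   others, and charge a common fee making the expected revenue vanish" gives
   each buyer the utility Opt/n; it is individually rational because
   E[max of the n - 1 others] >= (n - 1)/n Opt.  Mixing a little of it into the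
   Nash Solution cannot raise the Nash product, and this first-order condition
   together with the AM-HM inequality gives sum_i U_i >= n/(n + 1) Opt.  The
   bound (n - 1)/n Opt is what remains at one fixed mixing weight.

   The first-order condition requires the revenue and every U_i of the Nash
   Solution to be positive.  Its rules need not be Borel functions of the value
   profile, so U_i >= 0 does not follow from interim rationality by Fubini.
   Instead, the boundedness of the Nash product over all mechanisms is used.
   Call a payment rule costless if its interim expectations vanish; adding
   multiples of it to a mechanism preserves all constraints, so its ex-ante
   values must be the same for all buyers, otherwise some combination with a
   lump-sum refund makes the product unbounded.  If a costless rule with nonzero
   ex-ante value exists, n is odd and interim quantities do not depend on the
   buyer, so the U_i are all equal, and the positivity of the product and of the
   welfare decides the signs.  If none exists, ex-ante values are determined
   by interim values, and approximating the interim utility by Riemann sums of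
   the allocation gives U_i >= 0.

   If Opt is infinite, a posted price already has an infinite Nash product. *)

Set Implicit Arguments.
Unset Strict Implicit.
Unset Printing Implicit Defensive.

Local Open Scope classical_set_scope.
Local Open Scope ring_scope.

(** * Unbounded products and the first-order condition *)

(** The product is a polynomial in [K]. A factor contributes [b j], or [a j > 0] when [b j = 0], to
    its leading coefficient, which is positive because evenly many slopes are negative; a nonzero
    slope makes the degree at least 1. *)
Lemma prod_affine_unbounded (R : realType) (J : finType) (a b : J -> R) :
  (forall j, b j = 0 -> 0 < a j) -> ~~ odd #|[set j | b j < 0]%SET| ->
  (exists j, b j != 0) ->
  forall B, exists K, 0 <= K /\ B < \prod_j (a j + K * b j).
Proof.
move=> ab ev [j0 bj0] B.
pose l j := (a j)%:P + b j *: 'X : {poly R}.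
have szX j : b j != 0 -> size (b j *: 'X : {poly R}) = 2%N.
  by move=> b0; rewrite size_scale// size_polyX.
have ll j : lead_coef (l j) = if b j == 0 then a j else b j.
  rewrite /l; case: eqVneq => [->|b0]; first by rewrite scale0r addr0 lead_coefC.
  rewrite lead_coefDr; first by rewrite lead_coefZ lead_coefX mulr1.
  by rewrite szX// ltnS size_polyC leq_b1.
pose p := \prod_j l j.
have lj0 j : lead_coef (l j) != 0.
  by rewrite ll; case: (eqVneq (b j) 0) => [b0|//]; rewrite lt0r_neq0// ab.
have p0 : p != 0 by apply/prodf_neq0 => j _; rewrite -lead_coef_eq0.
have lp : 0 < lead_coef p.
  rewrite lead_coef_prod.
  rewrite (eq_bigr (fun j => (-1) ^+ (b j < 0)%R * `|lead_coef (l j)|)); last first.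
    move=> j _; rewrite [LHS]numEsign ll; congr (_ ^+ nat_of_bool _ * _).
    case: eqVneq => // b0; have := ab _ b0; rewrite b0 ltxx => aj.
    by apply/negbTE; rewrite -leNgt ltW.
  rewrite big_split/= prodrXr -big_mkcond/= sum1_card.
  have -> : #|[pred j | b j < 0]| = #|[set j | b j < 0]%SET|.
    by apply: eq_card => j; rewrite !inE.
  rewrite -signr_odd (negbTE ev) expr0 mul1r prodr_gt0// => j _.
  by rewrite normr_gt0.
have szp : (1 < size p)%N.
  apply: (@leq_trans (size (l j0))).
    by rewrite /l addrC size_polyDl szX// ltnS size_polyC leq_b1.
  by apply: dvdp_leq => //; rewrite /p (bigD1 j0)//= dvdp_mulr.
have lpB : 0 < lead_coef (p - B%:P).
  by rewrite lead_coefDl// size_polyN size_polyC; apply: leq_trans szp; rewrite ltnS leq_b1.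
have [K0 HK] := polyrcf.poly_pinfty_gt_lc lpB.
exists (Num.max 0 K0); split; first by rewrite le_max lexx.
have := HK (Num.max 0 K0); rewrite le_max lexx orbT => /(_ isT) /(lt_le_trans lpB).
rewrite !hornerE subr_gt0 /p horner_prod.
by under eq_bigr do rewrite !hornerE mulrC.
Qed.

Lemma bernoulli_ge (R : realType) (x : R) n : x <= 1 ->
  1 - n%:R * x <= (1 - x) ^+ n.
Proof.
move=> x1; elim: n => [|n IH]; first by rewrite mul0r subr0 expr0.
rewrite exprS; apply: (@le_trans _ _ ((1 - x) * (1 - n%:R * x))); last first.
  by apply: ler_wpM2l => //; rewrite subr_ge0.
rewrite -natr1; have : 0 <= n%:R * x ^+ 2 by rewrite mulr_ge0// sqr_ge0.
nra.
Qed.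

(** The terms of degree at least 2 in [l] of the expanded product are dropped. The extra factor [a]
    avoids the exponent n - 1. *)
Lemma prod_ge_linear (R : realType) n (a l : R) (r : 'I_n -> R) :
  0 <= a <= 1 -> 0 <= l -> (forall i, 0 <= r i) ->
  a ^+ n * (a + l * \sum_i r i) <= a * \prod_i (a + l * r i).
Proof.
move=> /andP[a0 a1] l0; elim: n r => [|n IH] r r0.
  by rewrite !big_ord0 mulr0 addr0 expr0 mul1r mulr1.
rewrite !big_ord_recr/= mulrA.
have r0' i : 0 <= r (widen_ord (leqnSn n) i) by [].
have := IH _ r0'; set p := \prod_i _; set s := \sum_i _ => IHn.
have s0 : 0 <= s by apply: sumr_ge0.
apply: (@le_trans _ _ (a ^+ n * (a + l * s) * (a + l * r ord_max))); last first.
  by apply: ler_wpM2r => //; rewrite addr_ge0// mulr_ge0.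
rewrite exprS -mulrA mulrCA; rewrite -[leRHS]mulrA ler_wpM2l ?exprn_ge0//.
have : 0 <= l * s * (l * r ord_max) by rewrite !mulr_ge0.
nra.
Qed.

(** A mechanism of zero revenue and common utility [o] is mixed with weight [l] into the maximizer,
    whose revenue is [P0] and whose utilities are [u]. That the product does not rise bounds the sum
    of [o / u i], and AM-HM turns this into a lower bound for the sum of [u i]. *)
Lemma nash_foc (R : realType) n (P0 o : R) (u : 'I_n -> R) :
  (0 < n)%N -> 0 < P0 -> 0 <= o -> (forall i, 0 < u i) ->
  (forall l, 0 <= l <= 1 ->
     (1 - l) * P0 * \prod_i ((1 - l) * u i + l * o) <= P0 * \prod_i u i) ->
  (n%:R - 1) * o <= \sum_i u i.
Proof.
case: n u => // -[|m] u _ P00 o0 u0 H.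
  by rewrite subrr mul0r sumr_ge0// => i _; exact: ltW.
set n := m.+2 in u u0 H *.
have n2 : 2 <= n%:R :> R by rewrite ler_nat.
pose N : R := n%:R.
(* With [l = 1 / (N * q)] the estimate [H2] reads [S <= N * q / (q - 1) + 1]. Since
   [q - 1 = N * (N - 1)], the right side is exactly [N ^+ 2 / (N - 1)], the bound on [S] that
   suffices after AM-HM. *)
pose q := N ^+ 2 - N + 1.
have q0 : 3 <= q by rewrite /q; rewrite -/N in n2; nra.
pose l := (N * q)^-1.
have Nq : 6 <= N * q by rewrite -/N in n2; nra.
have l0 : 0 < l by rewrite invr_gt0; lra.
have l1 : l <= 1 by rewrite /l invf_le1; lra.
have N0 : 0 < N by rewrite /N; lra.
pose r i := o / u i.
have r0 i : 0 <= r i by rewrite divr_ge0// ltW.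
pose S := \sum_i r i.
have U0 : 0 < \sum_i u i.
  by rewrite big_ord_recl ltr_pwDl// sumr_ge0// => i _; exact: ltW.
set U := \sum_i u i in U0 *.
have pu0 : 0 < \prod_i u i by exact: prodr_gt0.
have H1 : (1 - l) * \prod_i ((1 - l) + l * r i) <= 1.
  have := H l; rewrite (ltW l0) l1 => /(_ isT).
  rewrite (eq_bigr (fun i => u i * ((1 - l) + l * r i))); last first.
    by move=> i _; rewrite /r; have := u0 i => ?; field; rewrite gt_eqF.
  rewrite big_split/= => H1.
  rewrite -(ler_pM2l (mulr_gt0 P00 pu0)); lra.
have H2 : (1 - N * l) * (1 + l * (S - 1)) <= 1.
  have S0 : 0 <= 1 - l + l * S.
    by rewrite addr_ge0 ?subr_ge0// mulr_ge0 ?(ltW l0)// sumr_ge0.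
  have := @prod_ge_linear R n (1 - l) l r.
  rewrite subr_ge0 l1 lerBlDr lerDl (ltW l0) => /(_ isT isT r0) H3.
  apply: le_trans (le_trans H3 H1).
  have -> : 1 + l * (S - 1) = 1 - l + l * S by ring.
  by apply: ler_wpM2r => //; exact: bernoulli_ge.
have H3 : S * (N - 1) <= N ^+ 2.
  have e : 1 - N * l = (q - 1) / q by rewrite /l; field; rewrite !gt_eqF//; lra.
  have e2 : 1 + l * (S - 1) = (N * q + S - 1) / (N * q).
    by rewrite /l; field; rewrite !gt_eqF//; lra.
  move: H2; rewrite e e2 mulf_div ler_pdivrMr; last by nra.
  rewrite mul1r => H2.
  have N1 : 1 < N by rewrite /N; lra.
  have qN : q - 1 = N * (N - 1) by rewrite /q; ring.
  rewrite qN in H2.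
  have : (N - 1) * (N * q + S - 1) <= q ^+ 2.
    rewrite -(ler_pM2l N0); nra.
  rewrite /q; nra.
(* AM-HM, by summing the tangent line bounds for [o / x] at the mean [U / N]. *)
have H4 : o * N ^+ 2 <= S * U.
  have t i : o * (2 * N * U - N ^+ 2 * u i) <= r i * U ^+ 2.
    rewrite /r -[leRHS]mulrA; apply: ler_wpM2l => //.
    rewrite [leRHS]mulrC ler_pdivlMr//.
    have := sqr_ge0 (U - N * u i); nra.
  have : \sum_i o * (2 * N * U - N ^+ 2 * u i) <= \sum_i r i * U ^+ 2.
    by apply: ler_sum => i _.
  rewrite -mulr_sumr -mulr_suml -/S sumrB sumr_const card_ord -mulr_sumr -/U.
  rewrite -[X in o * (X - _)]mulr_natl -/N => H4.
  rewrite -(ler_pM2r U0); nra.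
have N1 : 0 < N - 1 by rewrite subr_gt0 /N; lra.
rewrite -/N -(ler_pM2l (exprn_gt0 2 N0)).
nra.
Qed.


(** Puts the seller's coordinate before those of the buyers, so that revenue and utilities form a
    single product of n + 1 affine factors. *)
Definition ocons (T : Type) n (x : T) (f : 'I_n -> T) (j : 'I_n.+1) : T :=
  if unlift ord0 j is Some i then f i else x.

Lemma ocons0 (T : Type) n (x : T) (f : 'I_n -> T) : ocons x f ord0 = x.
Proof. by rewrite /ocons unlift_none. Qed.

Lemma oconsS (T : Type) n (x : T) (f : 'I_n -> T) i : ocons x f (lift ord0 i) = f i.
Proof. by rewrite /ocons liftK. Qed.

Lemma ocons_prod (R : realType) n (x y K : R) (f g : 'I_n -> R) :
  \prod_j (ocons x f j + K * ocons y g j) = (x + K * y) * \prod_i (f i + K * g i).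
Proof.
by rewrite big_ord_recl !ocons0; congr (_ * _); apply: eq_bigr => i _; rewrite !oconsS.
Qed.

Lemma ocons_card_neg (R : realType) n (y : R) (g : 'I_n -> R) :
  #|[set j | (ocons y g j < 0)%R]%SET| = ((y < 0)%R + #|[set i | (g i < 0)%R]%SET|)%N.
Proof.
rewrite -!sum1_card big_mkcond big_ord_recl inE ocons0; congr (_ + _)%N.
by rewrite [RHS]big_mkcond; apply: eq_bigr => i _; rewrite !inE oconsS.
Qed.

Lemma oconsP n (Q : 'I_n.+1 -> Prop) :
  Q ord0 -> (forall i, Q (lift ord0 i)) -> forall j, Q j.
Proof. by move=> Q0 QS j; case: (unliftP ord0 j) => [i|] ->. Qed.

(** Let [m] be the mean of [e] and [d i = e i - m]. The lump sum [c = K * (eps - m)], nonnegative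
    since [m <= 0], turns the slopes of the utilities into [d i + eps] and that of the revenue into
    [- n * eps]. If [d] is not zero, some [eps] makes the number of negative slopes even, and the
    product is unbounded. *)
Lemma bounded_cone_line_constant_aux (R : realType) n (P0 B : R) (u e : 'I_n -> R) :
  0 < P0 -> (forall i, 0 < u i) -> \sum_i e i <= 0 ->
  (forall K c, 0 <= K -> 0 <= c ->
     (P0 - n%:R * c - K * \sum_i e i) * \prod_i (u i + c + K * e i) <= B) ->
  forall i j, e i = e j.
Proof.
move=> P00 u0 se H i j.
have n0 : 0 < n%:R :> R by rewrite ltr0n; apply: leq_ltn_trans (ltn_ord i).
pose m := (\sum_i e i) / n%:R.
have m0 : m <= 0 by rewrite mulr_le0_ge0// invr_ge0 ltW.
have nm : n%:R * m = \sum_i e i by rewrite /m mulrC divfK// gt_eqF.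
pose d i := e i - m.
suff d0 k : d k = 0 by have := d0 i; have := d0 j; rewrite /d; lra.
have sd : \sum_i d i = 0.
  by rewrite sumrB sumr_const card_ord -mulr_natl nm subrr.
apply/eqP/negPn/negP => dk.
have key eps : 0 <= eps -> forall (K : R), 0 <= K ->
    \prod_j (ocons P0 u j + K * ocons (- (n%:R * eps)) (fun i => d i + eps) j) <= B.
  move=> eps0 K K0.
  have c0 : 0 <= K * (eps - m) by rewrite mulr_ge0// subr_ge0 (le_trans m0).
  have := H K _ K0 c0; rewrite -nm => {}H.
  rewrite ocons_prod; apply: le_trans H; rewrite le_eqVlt; apply/orP; left; apply/eqP.
  congr (_ * _); first by ring.
  by apply: eq_bigr => l _; rewrite /d; ring.
have contra eps : 0 <= eps ->
    (eps = 0 \/ forall l, d l + eps != 0) ->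
    ~~ odd ((- (n%:R * eps) < 0)%R + #|[set i | (d i + eps < 0)%R]%SET|)%N -> False.
  move=> e0 ez ev.
  have [|||K [K0]] := @prod_affine_unbounded R 'I_n.+1
    (ocons P0 u) (ocons (- (n%:R * eps)) (fun i => d i + eps)) _ _ _ B.
  - apply: oconsP => [|l]; first by rewrite !ocons0.
    rewrite !oconsS => dl; case: ez => [ez|/(_ l)]; first exact: u0.
    by rewrite dl eqxx.
  - by rewrite ocons_card_neg.
  - case: ez => [->|nz]; last by exists (lift ord0 k); rewrite oconsS.
    by exists (lift ord0 k); rewrite oconsS addr0.
  - by rewrite ltNge => /negP; apply; apply: key.
(* If evenly many [d] are negative, [eps = 0] keeps the revenue constant; otherwise a small
   [eps > 0] makes the revenue decreasing, which corrects the parity. *)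
have [ev|/negPn od] := boolP (~~ odd #|[set i | (d i < 0)%R]%SET|).
  apply: (contra 0) => //; first by left.
  rewrite mulr0 oppr0 ltxx add0n; congr (~~ odd _): ev.
  by apply: eq_card => l; rewrite !inE addr0.
have [k0 k0n] : exists k0, d k0 < 0.
  case: (set_0Vmem [set i | (d i < 0)%R]%SET) => [dn|[k0]]; last by rewrite inE; exists k0.
  by move: od; rewrite dn cards0.
have [k1 k1n k1m] : exists2 k1, d k1 < 0 & forall l, d l < 0 -> d l <= d k1.
  have := @Order.TotalTheory.arg_maxP _ _ _ k0 (fun k => d k < 0) d k0n => -[k1 k1n k1m].
  by exists k1.
(* Half the distance from 0 to the nearest negative deviation: negative deviations stay negative,
   and no slope vanishes. *)
pose eps := - d k1 / 2.
have eps0 : 0 < eps by rewrite /eps; lra.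
have dneg l : (d l + eps < 0) = (d l < 0).
  by apply/idP/idP => [|/k1m]; rewrite /eps; lra.
apply: (contra eps); first exact: ltW.
  right=> l; apply/eqP => dl; have dl0 : d l < 0 by lra.
  by have := dneg l; rewrite dl dl0 ltxx.
rewrite oppr_lt0 mulr_gt0// oddD /= negbK.
congr (odd _): od; by apply: eq_card => l; rewrite !inE dneg.
Qed.

(* With [P0] the revenue and [u] the utilities, [K] scales a transfer [e] from
   the seller to the buyers and [c] is a lump sum paid to each of them. *)
Lemma bounded_line_constant (R : realType) n (P0 B : R) (u e : 'I_n -> R) :
  0 < P0 -> (forall i, 0 < u i) ->
  (forall K c, 0 <= c ->
     (P0 - n%:R * c - K * \sum_i e i) * \prod_i (u i + c + K * e i) <= B) ->
  forall i j, e i = e j.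
Proof.
move=> P00 u0 H i j; have [se|/ltW se] := leP (\sum_i e i) 0.
  by apply: (bounded_cone_line_constant_aux P00 u0 se (B := B)) => K c _; exact: H.
apply: oppr_inj; apply: (bounded_cone_line_constant_aux P00 u0 (e := fun i => - e i) (B := B)).
  by rewrite sumrN oppr_le0.
move=> K c _ c0; have := H (- K) c c0; rewrite sumrN mulNr mulrN.
by under eq_bigr do rewrite mulNr -mulrN.
Qed.

(** Charging every buyer [K] gives the revenue a positive slope and all n utilities a negative one;
    for even n the product would be unbounded. *)
Lemma bounded_refund_odd (R : realType) n (P0 B : R) (u : 'I_n -> R) :
  0 < P0 -> (0 < n)%N -> (forall i, 0 < u i) ->
  (forall K, 0 <= K -> (P0 + n%:R * K) * \prod_i (u i - K) <= B) -> odd n.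
Proof.
move=> P00 n0 u0 H; apply/negPn/negP => ev.
have [|||K [K0]] := @prod_affine_unbounded R 'I_n.+1
    (ocons P0 u) (ocons n%:R (fun=> -1)) _ _ _ B.
- by apply: oconsP => [|l]; rewrite ?ocons0// !oconsS => _; exact: u0.
- rewrite ocons_card_neg ltNge ler0n add0n.
  rewrite (_ : [set _ | _]%SET = [set: 'I_n]%SET) ?cardsT ?card_ord//.
  by apply/setP => l; rewrite !inE ltrN10.
- by exists ord0; rewrite ocons0 pnatr_eq0 -lt0n.
- rewrite ltNge => /negP; apply; rewrite ocons_prod [K * _]mulrC.
  by under eq_bigr do rewrite mulrN1; exact: H.
Qed.

(** * Expectations *)

Section Expectation.
Context (R : realType) (d : measure_display) (Omega : measurableType d).
Variable P : probability Omega R.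
Implicit Types f g : Omega -> R.

Definition summable_rv f := P.-integrable setT (EFin \o f).
Definition esp f : R := \int[P]_w f w.

Lemma srv_measurable f : summable_rv f -> measurable_fun setT f.
Proof. by move=> /integrableP[/measurable_EFinP]. Qed.

Lemma espE f : summable_rv f -> (\int[P]_w (f w)%:E)%E = (esp f)%:E.
Proof. by move=> sf; rewrite /esp /Rintegral fineK//; exact: integrable_fin_num. Qed.

Lemma srv_eq f g : f =1 g -> summable_rv f -> summable_rv g.
Proof. by move=> /funext ->. Qed.

Lemma srvD f g : summable_rv f -> summable_rv g -> summable_rv (fun w => f w + g w).
Proof.
by move=> sf sg; apply: (eq_integrable measurableT _ _ _ (integrableD measurableT sf sg)).
Qed.

Lemma srvB f g : summable_rv f -> summable_rv g -> summable_rv (fun w => f w - g w).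
Proof.
by move=> sf sg; apply: (eq_integrable measurableT _ _ _ (integrableB measurableT sf sg)).
Qed.

Lemma srvZ k f : summable_rv f -> summable_rv (fun w => k * f w).
Proof.
by move=> sf; apply: (eq_integrable measurableT _ _ _ (integrableZl measurableT k sf)).
Qed.

Lemma srv_cst k : summable_rv (fun=> k).
Proof. exact: finite_measure_integrable_cst. Qed.

Lemma srv_sum (I : Type) (s : seq I) (Q : pred I) (F : I -> Omega -> R) :
  (forall i, summable_rv (F i)) -> summable_rv (fun w => \sum_(i <- s | Q i) F i w).
Proof.
move=> sF; elim: s => [|i s IH].
  by apply: srv_eq (srv_cst 0) => w; rewrite big_nil.
have [Qi|Qi] := boolP (Q i).
  by apply: srv_eq (srvD (sF i) IH) => w; rewrite big_cons Qi.
by apply: srv_eq IH => w; rewrite big_cons (negbTE Qi).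
Qed.

Lemma espD f g : summable_rv f -> summable_rv g ->
  esp (fun w => f w + g w) = esp f + esp g.
Proof. by move=> sf sg; rewrite /esp RintegralD. Qed.

Lemma espB f g : summable_rv f -> summable_rv g ->
  esp (fun w => f w - g w) = esp f - esp g.
Proof. by move=> sf sg; rewrite /esp RintegralB. Qed.

Lemma espZ k f : summable_rv f -> esp (fun w => k * f w) = k * esp f.
Proof. by move=> sf; rewrite /esp RintegralZl. Qed.

Lemma esp_cst k : esp (fun=> k) = k.
Proof. by rewrite /esp Rintegral_cst// [X in fine X](@probability_setT _ _ _ P) mulr1. Qed.

Lemma eq_esp f g : f =1 g -> esp f = esp g.
Proof. by move=> /funext ->. Qed.

Lemma esp_sum (I : Type) (s : seq I) (Q : pred I) (F : I -> Omega -> R) :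
  (forall i, summable_rv (F i)) ->
  esp (fun w => \sum_(i <- s | Q i) F i w) = \sum_(i <- s | Q i) esp (F i).
Proof.
move=> sF; elim: s => [|i s IH].
  by rewrite big_nil -[RHS](esp_cst 0); apply: eq_esp => w; rewrite big_nil.
rewrite big_cons; have [Qi|Qi] := boolP (Q i).
  rewrite -IH -espD//; last exact: srv_sum.
  by apply: eq_esp => w; rewrite big_cons Qi.
by rewrite -IH; apply: eq_esp => w; rewrite big_cons (negbTE Qi).
Qed.

Lemma ae_le_esp f g : summable_rv f -> summable_rv g ->
  {ae P, forall w, f w <= g w} -> esp f <= esp g.
Proof.
move=> sf sg fg; rewrite -subr_ge0 -espB//.
have sB := srvB sg sf.
(* The difference is nonnegative only almost everywhere, so it is exchanged for its absolute
   value. *)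
have -> : esp (fun w => g w - f w) = esp (fun w => `|g w - f w|).
  rewrite /esp /Rintegral; congr fine; apply: ae_eq_integral => //.
  - exact: measurable_int sB.
  - by apply/measurable_EFinP; apply: measurableT_comp => //; exact: srv_measurable sB.
  - by apply: filterS fg => w fgw _; rewrite ger0_norm// subr_ge0.
by apply: Rintegral_ge0.
Qed.

Lemma le_esp f g : summable_rv f -> summable_rv g ->
  (forall w, f w <= g w) -> esp f <= esp g.
Proof. by move=> sf sg fg; apply: ae_le_esp => //; exact: aeW. Qed.

Lemma srv_dominated f g : measurable_fun setT f -> summable_rv g ->
  {ae P, forall w, `|f w| <= g w} -> summable_rv f.
Proof.
move=> mf sg fg; apply/integrableP; split; first exact/measurable_EFinP.
have /integrableP[mg] := sg; apply: le_lt_trans.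
apply: ae_ge0_le_integral => //.
- by apply: measurableT_comp => //; exact/measurable_EFinP.
- exact: measurableT_comp.
- by apply: filterS fg => w fgw _; rewrite /= lee_fin (le_trans fgw)// ler_norm.
Qed.

Lemma srv_bounded_mul (h : Omega -> R) f C : measurable_fun setT h ->
  (forall w, `|h w| <= C) -> summable_rv f -> summable_rv (fun w => h w * f w).
Proof.
move=> mh hC sf; apply: (@srv_dominated _ (fun w => C * `|f w|)).
- by apply: measurable_funM => //; exact: srv_measurable.
- apply: srvZ; exact: (integrable_norm sf).
- by apply: aeW => w; rewrite normrM ler_wpM2r.
Qed.

Lemma esp_cvg (h : nat -> Omega -> R) f :
  summable_rv f -> (forall m, measurable_fun setT (h m)) ->
  (forall m w, 0 <= h m w <= 1) ->
  {ae P, forall w, h ^~ w @ \oo --> (1 : R)} ->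
  esp (fun w => h m w * f w) @[m --> \oo] --> esp f.
Proof.
move=> sf mh h01 hcvg.
have mf := srv_measurable sf.
have sh m : summable_rv (fun w => h m w * f w).
  apply: (@srv_bounded_mul _ _ 1) => // w.
  by have /andP[? ?] := h01 m w; rewrite ger0_norm.
have [||||| _ _] := @dominated_convergence _ _ _ P setT measurableT
  (fun m => EFin \o (fun w => h m w * f w)) (EFin \o f) (EFin \o (Num.norm \o f)).
- by move=> m; exact/measurable_EFinP/srv_measurable.
- exact/measurable_EFinP.
- apply: filterS hcvg => w hw _; apply: cvg_EFin; first exact: nearW.
  rewrite -[X in _ --> X]mul1r; apply: cvgM => //; exact: cvg_cst.
- exact: integrable_norm.
- apply: aeW => w m _; rewrite /= lee_fin normrM -[leRHS]mul1r ler_wpM2r//.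
  by have /andP[? ?] := h01 m w; rewrite ger0_norm.
rewrite /= espE// => /fine_cvgP[_]; apply: cvg_trans.
by apply: near_eq_cvg; apply: nearW => m /=; rewrite espE.
Qed.

(** Makes the expectations of a bounded Borel function of one value agree across buyers. *)
Lemma esp_law (mu : probability R R) (X : Omega -> R) (phi : R -> R) C :
  measurable_fun setT X ->
  (forall B, measurable B -> P (X @^-1` B) = mu B) ->
  measurable_fun setT phi -> (forall x, `|phi x| <= C) ->
  esp (fun w => phi (X w)) = \int[mu]_x phi x.
Proof.
move=> mX lawX mphi phiC.
rewrite /esp /Rintegral; congr fine.
have iphi : P.-integrable setT ((EFin \o phi) \o X).
  apply: (@srv_dominated (fun w => phi (X w)) (fun=> C)); last exact: aeW.
  - exact: measurableT_comp.
  - exact: srv_cst.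
have := @integral_pushforward _ _ _ _ _ _ mX P setT (EFin \o phi) _ iphi measurableT.
rewrite preimage_setT => <-; last exact/measurable_EFinP.
by apply: eq_measure_integral => A mA _; exact: lawX.
Qed.

End Expectation.

(** * Payment rules and their interim values *)

Section Families.
Context (R : realType) (d : measure_display) (Omega : measurableType d).
Context (P : probability Omega R) (n : nat) (V : 'I_n -> Omega -> R).
Context (mu : probability R R).

Lemma upd_upd (v : 'I_n -> R) i s t : upd (upd v i t) i s = upd v i s.
Proof. by apply/funext => j; rewrite /upd; case: eqP. Qed.

Lemma updE (v : 'I_n -> R) i t : upd v i t i = t.
Proof. by rewrite /upd eqxx. Qed.

Lemma upd_perm (v : 'I_n -> R) (s : {perm 'I_n}) i t :
  upd (fun j => v (s j)) i t = (fun j => upd v (s i) t (s j)).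
Proof. by apply/funext => j; rewrite /upd (inj_eq perm_inj). Qed.

Definition rule := 'I_n -> ('I_n -> R) -> R.
Implicit Types (f g : rule) (phi : R -> R) (M : mechanism R n).

(** Integrability is imposed separately at random profiles and at profiles with the own type fixed.
    Joint measurability is not included, so [exante] cannot be obtained from [interim] by Fubini. *)
Definition admissible f : Prop :=
  [/\ forall (s : {perm 'I_n}) v i, f i (fun j => v (s j)) = f (s i) v,
      forall i, summable_rv P (fun w => f i (prof V w)) &
      forall i t, supp mu t -> summable_rv P (fun w => f i (upd (prof V w) i t))].

Definition interim f i t : R := esp P (fun w => f i (upd (prof V w) i t)).
Definition exante f i : R := esp P (fun w => f i (prof V w)).

(** The result ignores the own type: its interim value at every type and its ex-ante value are both
    the interim value of [f] at [t]. *)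
Definition freeze f (t : R) : rule := fun i v => f i (upd v i t).

Lemma adm_cst k : admissible (fun _ _ => k).
Proof. by split=> // *; exact: srv_cst. Qed.

Lemma adm_add f g : admissible f -> admissible g ->
  admissible (fun i v => f i v + g i v).
Proof.
move=> [f1 f2 f3] [g1 g2 g3]; split=> [s v i|i|i t st]; first by rewrite f1 g1.
- exact: srvD.
- by apply: srvD; [exact: f3|exact: g3].
Qed.

Lemma adm_sub f g : admissible f -> admissible g ->
  admissible (fun i v => f i v - g i v).
Proof.
move=> [f1 f2 f3] [g1 g2 g3]; split=> [s v i|i|i t st]; first by rewrite f1 g1.
- exact: srvB.
- by apply: srvB; [exact: f3|exact: g3].
Qed.

Lemma adm_scale k f : admissible f -> admissible (fun i v => k * f i v).
Proof.
move=> [f1 f2 f3]; split=> [s v i|i|i t st]; first by rewrite f1.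
- exact: srvZ.
- by apply: srvZ; exact: f3.
Qed.

Lemma adm_sum (I : Type) (r : seq I) (F : I -> rule) :
  (forall k, admissible (F k)) -> admissible (fun i v => \sum_(k <- r) F k i v).
Proof.
move=> aF; split=> [s v i|i|i t st].
- by apply: eq_bigr => k _; case: (aF k) => ->.
- by apply: srv_sum => k; case: (aF k).
- by apply: srv_sum => k; case: (aF k) => _ _; exact.
Qed.

Lemma adm_freeze f t : supp mu t -> admissible f -> admissible (freeze f t).
Proof.
move=> st [f1 f2 f3]; split=> [s v i|i|i t' st'].
- by rewrite /freeze upd_perm f1.
- exact: f3.
- by apply: srv_eq (f3 i t st) => w; rewrite /freeze upd_upd.
Qed.

Lemma adm_weight phi f C : (forall i, measurable_fun setT (V i)) ->
  measurable_fun setT phi -> (forall x, `|phi x| <= C) ->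
  admissible f -> admissible (fun i v => phi (v i) * f i v).
Proof.
move=> mV mphi pC [f1 f2 f3]; split=> [s v i|i|i t st]; first by rewrite f1.
- apply: (@srv_bounded_mul _ _ _ _ (fun w => phi (V i w)) _ C) => //.
  exact: measurableT_comp.
- by apply: srv_eq (srvZ (phi t) (f3 i t st)) => w; rewrite updE.
Qed.

Lemma interim_cst k i t : interim (fun _ _ => k) i t = k.
Proof. exact: esp_cst. Qed.

Lemma exante_cst k i : exante (fun _ _ => k) i = k.
Proof. exact: esp_cst. Qed.

Lemma interimD f g i t : supp mu t -> admissible f -> admissible g ->
  interim (fun i v => f i v + g i v) i t = interim f i t + interim g i t.
Proof. by move=> st [_ _ f3] [_ _ g3]; rewrite /interim espD//; [exact: f3|exact: g3]. Qed.

Lemma interimB f g i t : supp mu t -> admissible f -> admissible g ->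
  interim (fun i v => f i v - g i v) i t = interim f i t - interim g i t.
Proof. by move=> st [_ _ f3] [_ _ g3]; rewrite /interim espB//; [exact: f3|exact: g3]. Qed.

Lemma interimZ k f i t : supp mu t -> admissible f ->
  interim (fun i v => k * f i v) i t = k * interim f i t.
Proof. by move=> st [_ _ f3]; rewrite /interim espZ//; exact: f3. Qed.

Lemma interim_sum (I : Type) (r : seq I) (F : I -> rule) i t : supp mu t ->
  (forall k, admissible (F k)) ->
  interim (fun i v => \sum_(k <- r) F k i v) i t = \sum_(k <- r) interim (F k) i t.
Proof.
by move=> st aF; rewrite /interim esp_sum// => k; case: (aF k) => _ _; exact.
Qed.

Lemma interim_freeze f s i t : interim (freeze f s) i t = interim f i s.
Proof. by apply: eq_esp => w; rewrite /freeze upd_upd. Qed.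

Lemma interim_weight phi f i t : supp mu t -> admissible f ->
  interim (fun i v => phi (v i) * f i v) i t = phi t * interim f i t.
Proof.
move=> st [_ _ f3]; rewrite /interim -espZ; last exact: f3.
by apply: eq_esp => w; rewrite updE.
Qed.

Lemma exanteD f g i : admissible f -> admissible g ->
  exante (fun i v => f i v + g i v) i = exante f i + exante g i.
Proof. by move=> [_ f2 _] [_ g2 _]; rewrite /exante espD. Qed.

Lemma exanteB f g i : admissible f -> admissible g ->
  exante (fun i v => f i v - g i v) i = exante f i - exante g i.
Proof. by move=> [_ f2 _] [_ g2 _]; rewrite /exante espB. Qed.

Lemma exanteZ k f i : admissible f ->
  exante (fun i v => k * f i v) i = k * exante f i.
Proof. by move=> [_ f2 _]; rewrite /exante espZ. Qed.

Lemma exante_sum (I : Type) (r : seq I) (F : I -> rule) i :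
  (forall k, admissible (F k)) ->
  exante (fun i v => \sum_(k <- r) F k i v) i = \sum_(k <- r) exante (F k) i.
Proof. by move=> aF; rewrite /exante esp_sum// => k; case: (aF k). Qed.

Lemma exante_freeze f s i : exante (freeze f s) i = interim f i s.
Proof. by []. Qed.

Hypothesis mV : forall i, measurable_fun setT (V i).
Hypothesis Vsupp : {ae P, forall w, forall i, supp mu (V i w)}.

Lemma feasible_le1 M v : ex_post_feasible mu M -> (forall j, supp mu (v j)) ->
  forall i, 0 <= alloc M i v <= 1.
Proof.
move=> fM sv i; have [a0 a1] := fM v sv; rewrite a0/=; apply: le_trans a1.
by rewrite (bigD1 i)//= lerDl sumr_ge0.
Qed.

Lemma prof_ae_supp : {ae P, forall w, forall j, supp mu (prof V w j)}.
Proof. exact: Vsupp. Qed.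

Lemma upd_ae_supp i t : supp mu t ->
  {ae P, forall w, forall j, supp mu (upd (prof V w) i t j)}.
Proof.
move=> st; apply: filterS Vsupp => w sw j.
by rewrite /upd; case: ifP => // _; exact: sw.
Qed.

Lemma feasible_adm M : ex_post_feasible mu M ->
  (forall i, measurable_fun setT (fun w => alloc M i (prof V w))) ->
  (forall i t, supp mu t -> measurable_fun setT (fun w => alloc M i (upd (prof V w) i t))) ->
  (forall (s : {perm 'I_n}) v i, alloc M i (fun j => v (s j)) = alloc M (s i) v) ->
  admissible (alloc M).
Proof.
move=> fM m1 m2 sM; split=> // [i|i t st].
- apply: (srv_dominated (m1 i) (srv_cst P 1)).
  apply: filterS prof_ae_supp => w sw.
  by have /andP[? ?] := feasible_le1 fM sw i; rewrite ger0_norm.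
- apply: (srv_dominated (m2 i t st) (srv_cst P 1)).
  apply: filterS (upd_ae_supp i st) => w sw.
  by have /andP[? ?] := feasible_le1 fM sw i; rewrite ger0_norm.
Qed.

Definition real_BIC M := forall i t t', supp mu t -> supp mu t' ->
  t * interim (alloc M) i t' - interim (pay M) i t' <=
  t * interim (alloc M) i t - interim (pay M) i t.
Definition real_IR M := forall i t, supp mu t ->
  0 <= t * interim (alloc M) i t - interim (pay M) i t.

Lemma interim_utilE M i t t' : admissible (alloc M) -> admissible (pay M) ->
  supp mu t' -> interim_util P V M i t t' =
  (t * interim (alloc M) i t' - interim (pay M) i t')%:E.
Proof.
move=> [_ _ a3] [_ _ p3] st; rewrite /interim_util /interim_alloc /interim_pay.
by rewrite !espE; [rewrite -EFinM -EFinB|exact: p3|exact: a3].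
Qed.

(** Feasible allocations lie in [0, 1] almost surely, hence are integrable, and all interim
    quantities are finite; membership becomes a statement about real numbers. *)
Lemma frakMP M : in_frakM P V mu M <->
  [/\ ex_post_feasible mu M, admissible (alloc M), admissible (pay M),
      real_BIC M & real_IR M].
Proof.
split=> [[wM fM bM iM sM]|[fM aM pM bM iM]].
  have aM : admissible (alloc M).
    apply: feasible_adm => // [i|i t st|s v i]; last by case: (sM s v i).
      by case: (wM i).
    by case: (wM i) => _ _ + _; exact.
  have pM : admissible (pay M).
    split=> [s v i|i|i t st]; first by case: (sM s v i).
      by case: (wM i).
    by case: (wM i) => _ _ _; exact.
  split=> // [i t t' st st'|i t st].
    by have := bM i t t' st st'; rewrite !interim_utilE// lee_fin.
  by have := iM i t st; rewrite interim_utilE// lee_fin.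
have [a1 a2 a3] := aM; have [p1 p2 p3] := pM.
split=> // [i|i t t' st st'|i t st].
- split; first exact: srv_measurable (a2 i).
  + exact: p2.
  + by move=> t st; exact: srv_measurable (a3 i t st).
  + by move=> t st; exact: p3.
- by rewrite !interim_utilE// lee_fin; exact: bM.
- by rewrite interim_utilE// lee_fin; exact: iM.
Qed.

Lemma revenueE M : admissible (pay M) ->
  revenue P V M = (\sum_i exante (pay M) i)%:E.
Proof.
move=> [_ p2 _]; rewrite /revenue -sumEFin.
by apply: eq_bigr => i _; rewrite espE//; exact: p2.
Qed.

Definition surplus M : rule := fun i v => v i * alloc M i v - pay M i v.

Hypothesis Vge0 : {ae P, forall w, forall i, 0 <= V i w}.
Hypothesis sV : forall i, summable_rv P (V i).

Lemma value_alloc_srv M i : ex_post_feasible mu M -> admissible (alloc M) ->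
  summable_rv P (fun w => V i w * alloc M i (prof V w)).
Proof.
move=> fM [_ a2 _].
apply: (@srv_dominated _ _ _ _ _ (fun w => V i w + 0)).
- by apply: measurable_funM => //; exact: srv_measurable (a2 i).
- exact: srvD (sV i) (srv_cst P 0).
apply: filterS2 Vge0 prof_ae_supp => w v0 sw.
have /andP[a0 a1] := feasible_le1 fM sw i.
by rewrite addr0 normrM !ger0_norm// -[leRHS]mulr1 ler_wpM2l.
Qed.

Lemma surplus_adm M : ex_post_feasible mu M -> admissible (alloc M) ->
  admissible (pay M) -> admissible (surplus M).
Proof.
move=> fM aM pM; apply: adm_sub => //.
have [a1 a2 a3] := aM; split=> [s v i|i|i t st].
- by rewrite a1.
- exact: value_alloc_srv.
- by apply: srv_eq (srvZ t (a3 i t st)) => w; rewrite updE.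
Qed.

Lemma interim_surplus M i t : admissible (alloc M) -> admissible (pay M) ->
  supp mu t ->
  interim (surplus M) i t = t * interim (alloc M) i t - interim (pay M) i t.
Proof.
move=> [_ _ a3] [_ _ p3] st; rewrite /interim -espZ; last exact: a3.
rewrite -espB; [|exact: srvZ (a3 i t st)|exact: p3].
by apply: eq_esp => w; rewrite /surplus updE.
Qed.

Lemma buyer_utilE M i : ex_post_feasible mu M -> admissible (alloc M) ->
  admissible (pay M) -> buyer_util P V M i = (exante (surplus M) i)%:E.
Proof.
move=> fM aM pM; have [_ p2 _] := pM.
have sVa := value_alloc_srv i fM aM.
by rewrite /buyer_util (espE sVa) (espE (p2 i)) /exante /surplus espB.
Qed.

End Families.

(** * Spanning families and Riemann sums *)

(** A finite family in [Y] of maximal rank spans [Y], since adjoining a further vector cannot raise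
    the rank. The pseudoinverse makes the coefficients linear in [y], hence measurable or small when
    [y] is. *)
Lemma finite_spanning_family (R : realType) n (Y : set 'rV[R]_n) :
  exists m (b : 'I_m -> 'rV[R]_n) (L : 'M[R]_(n, m)),
    (forall j, Y (b j)) /\
    forall y, Y y -> forall i, y 0 i = \sum_j (\sum_l y 0 l * L l j) * b j 0 i.
Proof.
pose Q r := `[< exists m (b : 'I_m -> 'rV[R]_n), (forall j, Y (b j)) /\
  \rank (\matrix_j b j) = r >].
have Q0 : exists r, Q r.
  exists 0%N; apply/asboolP; exists 0%N, (fun=> 0); split; first by case.
  by apply/eqP; rewrite -leqn0 rank_leq_row.
have Qn r : Q r -> (r <= n)%N.
  by move=> /asboolP[m [b [_ <-]]]; exact: rank_leq_col.
have [r /asboolP[m [b [Yb rb]]] rmax] := ex_maxnP Q0 Qn.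
exists m, b, (pinvmx (\matrix_j b j)); split=> // y Yy i.
set Bm := \matrix_j b j in rb *.
have yB : (y <= Bm)%MS.
  pose b' (j : 'I_(m + 1)) := match fintype.split j with inl k => b k | inr _ => y end.
  have e : \matrix_j b' j = col_mx Bm y.
    apply/row_matrixP => j; rewrite rowK /b'; case: splitP => k jk.
      rewrite (_ : j = lshift 1 k); last exact: val_inj.
      by rewrite rowKu rowK.
    rewrite (_ : j = rshift m k); last exact: val_inj.
    by rewrite rowKd (ord1 k); apply/rowP => l; rewrite !mxE.
  have : (\rank (col_mx Bm y) <= r)%N.
    apply: rmax; apply/asboolP; exists (m + 1)%N, b'; split; last by rewrite e.
    by move=> j; rewrite /b'; case: fintype.split.
  rewrite -rb => rk.
  have /andP[sB sy] : (Bm <= col_mx Bm y)%MS && (y <= col_mx Bm y)%MS.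
    by rewrite -col_mx_sub submx_refl.
  apply: submx_trans sy _.
  by rewrite -(geq_leqif (mxrank_leqif_sup sB)).
rewrite -[in LHS](mulmxKpV yB) mxE; apply: eq_bigr => j _.
by rewrite !mxE; congr (_ * _); apply: eq_bigr => l _; rewrite mxE.
Qed.

(* A discrete version of the envelope formula [G t = G vL + int A]. *)
Lemma grid_envelope (R : realType) (G A : R -> R) (vL H : R) (N : nat) :
  (0 < N)%N -> vL <= H ->
  (forall s t, vL <= s -> s <= t -> t <= H ->
     (t - s) * A s <= G t - G s <= (t - s) * A t) ->
  (forall t, vL <= t -> t <= H -> 0 <= A t <= 1) ->
  let D := (H - vL) / N%:R in
  forall t, vL <= t -> t <= H ->
  0 <= G t - G vL - \sum_(k < N) (D * (vL + k.+1%:R * D <= t)%R%:R) * A (vL + k%:R * D) <= 2 * D.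
Proof.
move=> N0 vH GA A01 D t vt tH.
have N0' : 0 < N%:R :> R by rewrite ltr0n.
have D0 : 0 <= D by rewrite divr_ge0 ?subr_ge0// ltW.
have ND : N%:R * D = H - vL by rewrite /D mulrC divfK// gt_eqF.
pose s (k : nat) := vL + k%:R * D.
have s0 : s 0%N = vL by rewrite /s mul0r addr0.
have sS k : s k.+1 = s k + D by rewrite /s -natr1; ring.
have smono k l : (k <= l)%N -> s k <= s l.
  by move=> kl; rewrite /s lerD2l ler_wpM2r// ler_nat.
have sv k : vL <= s k by rewrite -s0 smono.
have sN : s N = H by rewrite /s ND; ring.
(* The largest such [m] is the index of the last grid point up to [t]; the sum counts exactly the
   cells before it. *)
pose Q m := (m <= N)%N && (s m <= t).
have Q0 : exists m, Q m by exists 0%N; rewrite /Q s0.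
have QN m : Q m -> (m <= N)%N by case/andP.
have [m /andP[mN smt] mmax] := ex_maxnP Q0 QN.
have -> : \sum_(k < N) (D * (vL + k.+1%:R * D <= t)%R%:R) * A (vL + k%:R * D) =
          \sum_(k < m) D * A (s k).
  rewrite (big_ord_widen _ (fun k => D * A (s k)) mN) [RHS]big_mkcond/=.
  apply: eq_bigr => k _; rewrite -/(s k.+1) -/(s k).
  have [km|mk] := ltnP k m.
    by rewrite (le_trans (smono _ _ km) smt) mulr1.
  case: (leP (s k.+1) t) => [skt|_]; last by rewrite mulr0 mul0r.
  have := mmax k.+1; rewrite /Q skt (ltn_ord k) => /(_ isT).
  by rewrite ltnNge mk.
have tsm : t - s m <= D.
  have [mltN|] := ltnP m N.
    have [smt'|] := leP (s m.+1) t.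
      by have := mmax m.+1; rewrite /Q smt' mltN => /(_ isT); rewrite ltnn.
    by rewrite sS; lra.
  move=> Nm; have mE : m = N by apply/eqP; rewrite eqn_leq mN.
  by move: smt; rewrite mE sN; lra.
(* The error of the left Riemann sum telescopes: each cell adds at most [D] times the increment of
   [A] across it. *)
have ind l : (l <= m)%N -> 
    0 <= G (s l) - G vL - \sum_(k < l) D * A (s k) <= D * (A (s l) - A vL).
  elim: l => [|l IH] lm; first by rewrite big_ord0 s0 !subrr mulr0 lexx.
  have slH : s l.+1 <= H by apply: le_trans tH; apply: le_trans smt; exact: smono.
  have /andP[g1 g2] := GA (s l) (s l.+1) (sv _) (smono _ _ (leqnSn _)) slH.
  have /andP[i1 i2] := IH (ltnW lm).
  rewrite big_ord_recr/=.
  have e : s l.+1 - s l = D by rewrite sS; ring.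
  rewrite e in g1 g2; apply/andP; split; lra.
have /andP[i1 i2] := ind m (leqnn m).
(* The incomplete cell from [s m] to [t] adds at most another [D]. *)
have /andP[g1 g2] := GA (s m) t (sv m) smt tH.
have /andP[a1 a2] := A01 t vt tH.
have /andP[a3 a4] := A01 (s m) (sv m) (le_trans smt tH).
have /andP[a5 a6] := A01 vL (lexx _) vH.
have p1 : 0 <= (t - s m) * A (s m) by rewrite mulr_ge0// subr_ge0.
have p2 : (t - s m) * A t <= D by rewrite -[leRHS]mulr1 ler_pM// subr_ge0.
have p3 : D * (A (s m) - A vL) <= D by rewrite -[leRHS]mulr1 ler_wpM2l//; lra.
apply/andP; split; lra.
Qed.

(** Precomposition with it extends a function monotone on [a, b] to a monotone, hence Borel,
    function on the line. *)
Definition clamp (R : realType) (a b t : R) := Num.max a (Num.min t b).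

Lemma clamp_id (R : realType) (a b t : R) : a <= t -> t <= b -> clamp a b t = t.
Proof. by move=> at_ tb; rewrite /clamp min_l// max_r. Qed.

Lemma clamp_bounds (R : realType) (a b t : R) : a <= b -> a <= clamp a b t <= b.
Proof. by move=> ab; rewrite /clamp le_max lexx/= ge_max ab ge_min lexx orbT. Qed.

Lemma clamp_mono (R : realType) (a b s t : R) : s <= t -> clamp a b s <= clamp a b t.
Proof.
move=> st; rewrite /clamp ge_max !le_max lexx/= le_min !ge_min lexx st orbT/=.
by rewrite orbT.
Qed.

Lemma clamp_measurable (R : realType) (F : R -> R) (a b : R) : a <= b ->
  (forall s t, a <= s -> s <= t -> t <= b -> F s <= F t) ->
  measurable_fun setT (fun t => F (clamp a b t)).
Proof.
move=> ab mono; apply: nondecreasing_measurable => // s t st.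
have /andP[? _] := clamp_bounds s ab; have /andP[_ ?] := clamp_bounds t ab.
by apply: mono => //; exact: clamp_mono.
Qed.

(** * Positivity at the Nash Solution *)

Section NashPositivity.
Context (R : realType) (d : measure_display) (Omega : measurableType d).
Context (P : probability Omega R) (n : nat) (V : 'I_n -> Omega -> R).
Context (mu : probability R R).
Hypothesis n_gt0 : (0 < n)%N.
Hypothesis mV : forall i, measurable_fun setT (V i).
Hypothesis lawV : forall i (B : set R), measurable B -> P (V i @^-1` B) = mu B.
Hypothesis Vsupp : {ae P, forall w, forall i, supp mu (V i w)}.
Hypothesis Vge0 : {ae P, forall w, forall i, 0 <= V i w}.
Hypothesis sV : forall i, summable_rv P (V i).
Context (vL : R).
Hypothesis supp_vL : supp mu vL.
Hypothesis supp_itv : forall s t, supp mu t -> vL <= s -> s <= t -> supp mu s.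
Hypothesis supp_ge : forall t, supp mu t -> vL <= t.
Context (Hs : nat -> R).
Hypothesis supp_Hs : forall m, supp mu (Hs m).
Hypothesis Hs_exhaust : forall x, supp mu x -> \forall m \near \oo, x <= Hs m.

Local Notation rule := (rule R n).
Local Notation admissible := (admissible P V mu).
Local Notation interim := (interim P V).
Local Notation exante := (exante P V).
Local Notation frakM := (in_frakM P V mu).
Implicit Types (f g h : rule) (M : mechanism R n).

Definition seller_rev M := \sum_i exante (pay M) i.
Definition buyer_gain M i := exante (surplus M) i.

Definition give M f : mechanism R n :=
  Mechanism (alloc M) (fun i v => pay M i v - f i v).

(* Refunds whose interim value does not depend on the own type do not affect
   incentives. *)
Definition gift f := admissible f /\
  forall i, exists2 k, 0 <= k & forall t, supp mu t -> interim f i t = k.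

(** These rules form a linear space, so multiples of either sign can be added to a mechanism. *)
Definition costless f := admissible f /\
  forall i t, supp mu t -> interim f i t = 0.

Lemma give_frakM M f : frakM M -> gift f -> frakM (give M f).
Proof.
move=> /(frakMP Vsupp _)[fM aM pM bM iM] [af gf]; apply/(frakMP Vsupp _); split=> //.
- exact: adm_sub.
- move=> i t t' st st'; rewrite /= (interimB _ st' pM af) (interimB _ st pM af).
  have [k _ kf] := gf i; rewrite !kf//.
  by have := bM i t t' st st'; lra.
- move=> i t st; rewrite /= (interimB _ st pM af).
  have [k k0 kf] := gf i; rewrite kf//.
  by have := iM i t st; lra.
Qed.

Lemma rev_give M f : frakM M -> admissible f ->
  seller_rev (give M f) = seller_rev M - \sum_i exante f i.
Proof.
move=> /(frakMP Vsupp _)[_ _ pM _ _] af.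
by rewrite /seller_rev -sumrB; apply: eq_bigr => i _; rewrite /= (exanteB _ pM af).
Qed.

Lemma surplus_frakM M : frakM M -> admissible (surplus M).
Proof. by move=> /(frakMP Vsupp _)[fM aM pM _ _]; exact: surplus_adm. Qed.

Lemma util_give M f i : frakM M -> admissible f ->
  buyer_gain (give M f) i = buyer_gain M i + exante f i.
Proof.
move=> fM af; rewrite /buyer_gain -(exanteD _ (surplus_frakM fM) af).
by apply: eq_esp => w; rewrite /surplus /=; ring.
Qed.

Lemma nash_objE M : frakM M ->
  nash_objective P V M = (seller_rev M * \prod_i buyer_gain M i)%:E.
Proof.
move=> /(frakMP Vsupp _)[fM aM pM _ _].
rewrite /nash_objective (revenueE pM) EFinM; congr (_ * _)%E.
rewrite -prodEFin.
by apply: eq_bigr => i _; rewrite (buyer_utilE mV Vsupp Vge0 sV _ fM aM pM).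
Qed.

(** Payments cancel, which leaves the expected values of the allocations. *)
Lemma welfare_ge0 M : frakM M -> 0 <= seller_rev M + \sum_i buyer_gain M i.
Proof.
move=> /(frakMP Vsupp _)[fM aM [_ p2 _] _ _].
rewrite /seller_rev -big_split/=; apply: sumr_ge0 => i _.
have sVa := value_alloc_srv mV Vsupp Vge0 sV i fM aM.
rewrite /buyer_gain /exante /surplus espB// addrC subrK -(esp_cst P 0).
apply: ae_le_esp => //; first exact: srv_cst.
apply: filterS2 Vge0 (prof_ae_supp Vsupp) => w v0 sw.
by have /andP[a0 _] := feasible_le1 fM sw i; apply: mulr_ge0 => //; exact: v0.
Qed.

Context (M1 : mechanism R n) (M : mechanism R n).
Hypothesis M1frakM : frakM M1.
Hypothesis rev1 : 0 < seller_rev M1.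
Hypothesis util1 : forall i, 0 < buyer_gain M1 i.
Hypothesis MfrakM : frakM M.
Hypothesis nashM : forall M', frakM M' ->
  (nash_objective P V M' <= nash_objective P V M)%E.

Let B := seller_rev M * \prod_i buyer_gain M i.

(** The reference mechanism [M1] together with a gift is again in the class, where the maximizer [M]
    bounds the Nash product. *)
Lemma gift_bounded f : gift f ->
  (seller_rev M1 - \sum_i exante f i) * \prod_i (buyer_gain M1 i + exante f i) <= B.
Proof.
move=> gf; have af := gf.1.
have gM := give_frakM M1frakM gf.
have := nashM gM; rewrite !nash_objE// lee_fin rev_give//.
by under eq_bigr do rewrite util_give//.
Qed.

Lemma objective_gt0 : 0 < B.
Proof.
have := nashM M1frakM; rewrite !nash_objE// lee_fin; apply: lt_le_trans.
by rewrite mulr_gt0// prodr_gt0.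
Qed.

Lemma lump_exante (K c : R) f i (af : admissible f) :
  exante (fun i v => c + K * f i v) i = c + K * exante f i.
Proof.
rewrite (exanteD i (adm_cst P V mu c) (adm_scale K af)).
by rewrite exante_cst (exanteZ _ _ af).
Qed.

(** Here gifts realize every multiple of the ex-ante values of [f] shifted by any lump sum [c >= 0];
    a Nash product bounded along all of them forces a constant direction. *)
Lemma gift_line_constant f : admissible f ->
  (forall K c, 0 <= c -> exists2 g, gift g &
     forall i, exante g i = c + K * exante f i) ->
  forall i j, exante f i = exante f j.
Proof.
move=> af H; apply: (bounded_line_constant rev1 util1 (B := B)) => K c c0.
have [g gg ge] := H K c c0.
have := gift_bounded gg.
have -> : \sum_i exante g i = n%:R * c + K * \sum_i exante f i.
  under eq_bigr do rewrite ge.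
  by rewrite big_split/= sumr_const card_ord -mulr_sumr mulr_natl.
have -> : \prod_i (buyer_gain M1 i + exante g i) = \prod_i (buyer_gain M1 i + c + K * exante f i).
  by apply: eq_bigr => i' _; rewrite ge addrA.
by rewrite opprD addrA.
Qed.

Lemma costless_constant f : costless f -> forall i j, exante f i = exante f j.
Proof.
move=> [af zf]; apply: gift_line_constant => // K c c0.
exists (fun i v => c + K * f i v); last by move=> i; exact: lump_exante af.
split; first by apply: adm_add (adm_cst _ _ _ _) (adm_scale _ af).
move=> i; exists c => // t st.
rewrite (interimD _ st (adm_cst _ _ _ _) (adm_scale _ af)) interim_cst.
by rewrite (interimZ _ _ st af) zf// mulr0 addr0.
Qed.

Let G := interim (surplus M).
Let A := interim (alloc M).

Lemma surplusM_adm : admissible (surplus M).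
Proof. exact: surplus_frakM. Qed.

(** Incentive compatibility between the two types, used in both directions. *)
Lemma interim_slope i s t : supp mu s -> supp mu t ->
  (t - s) * A i s <= G i t - G i s <= (t - s) * A i t.
Proof.
move: MfrakM => /(frakMP Vsupp _)[fM aM pM bM iM] ss st.
rewrite /G (interim_surplus _ aM pM st) (interim_surplus _ aM pM ss) -/A.
have := bM i t s st ss; have := bM i s t ss st; rewrite -/(A) => h1 h2.
by apply/andP; split; lra.
Qed.

Lemma interim_alloc_bounds i t : supp mu t -> 0 <= A i t <= 1.
Proof.
move: MfrakM => /(frakMP Vsupp _)[fM [_ _ a3] pM bM iM] st.
have b := upd_ae_supp Vsupp i st.
apply/andP; split.
  rewrite -(esp_cst P 0); apply: ae_le_esp; [exact: srv_cst|exact: a3|].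
  by apply: filterS b => w sw; have /andP[] := feasible_le1 fM sw i.
rewrite -(esp_cst P 1); apply: ae_le_esp; [exact: a3|exact: srv_cst|].
by apply: filterS b => w sw; have /andP[] := feasible_le1 fM sw i.
Qed.

Lemma interim_surplus_mono i s t : supp mu s -> supp mu t -> s <= t -> G i s <= G i t.
Proof.
move=> ss st stl; have /andP[h _] := interim_slope i ss st.
have /andP[a0 _] := interim_alloc_bounds i ss.
by rewrite -subr_ge0; apply: le_trans h; rewrite mulr_ge0// subr_ge0.
Qed.

Definition below (H x : R) : R := (x <= H)%R%:R.

Lemma below_measurable H : measurable_fun setT (below H).
Proof.
apply: nonincreasing_measurable => // x y xy; rewrite /below.
by case: (leP y H) => // yH; rewrite (le_trans xy yH).
Qed.

Lemma below01 H x : 0 <= below H x <= 1.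
Proof. by rewrite /below; case: (x <= H); rewrite ?lexx ?ler01. Qed.

Lemma below_norm H x : `|below H x| <= 1.
Proof. by have /andP[? ?] := below01 H x; rewrite ger0_norm. Qed.

(** Restricting own types to at most [H] keeps the interim utility bounded, as a weight on rules has
    to be; letting [H] run through [Hs] recovers the full expectation. *)
Definition trunc H f : rule := fun i v => below H (v i) * f i v.

Lemma adm_trunc H f : admissible f -> admissible (trunc H f).
Proof. exact: adm_weight mV (below_measurable H) (below_norm H). Qed.

Lemma exante_trunc_cvg f i : admissible f ->
  exante (trunc (Hs m) f) i @[m --> \oo] --> exante f i.
Proof.
move=> [_ f2 _]; apply: (@esp_cvg _ _ _ P (fun m w => below (Hs m) (V i w))) => //.
- by move=> m; apply: measurableT_comp => //; exact: below_measurable.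
- by move=> m w; exact: below01.
apply: filterS Vsupp => w sw.
apply: cvg_near_cst; apply: filterS (Hs_exhaust (sw i)) => m Hm.
by rewrite /below Hm.
Qed.

(** * The case of a costless rule with nonzero ex-ante value *)

Section LumpLine.
Context (dl : rule) (i0 : 'I_n).
Hypothesis dl0 : costless dl.
Hypothesis dl_neq0 : exante dl i0 != 0.

Let kap := exante dl i0.

(** A multiple of [dl] takes [K] from every buyer ex ante at no interim cost, for every [K >= 0]. *)
Lemma lump_line_odd : odd n.
Proof.
apply: (bounded_refund_odd rev1 n_gt0 util1 (B := B)) => K K0.
have [adl zdl] := dl0.
have g : gift (fun i v => 0 + (- K / kap) * dl i v).
  split; first by apply: adm_add (adm_cst _ _ _ _) (adm_scale _ adl).
  move=> i; exists 0 => // t st.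
  rewrite (interimD _ st (adm_cst _ _ _ _) (adm_scale _ adl)) interim_cst.
  by rewrite (interimZ _ _ st adl) zdl// mulr0 addr0.
have e i : exante (fun i v => 0 + (- K / kap) * dl i v) i = - K.
  by rewrite (lump_exante _ _ _ adl) (costless_constant dl0 i i0) add0r divfK.
have := gift_bounded g.
have -> : \sum_i exante (fun i v => 0 + (- K / kap) * dl i v) i = - (n%:R * K).
  under eq_bigr do rewrite e.
  by rewrite sumr_const card_ord mulNrn mulr_natl.
have -> : \prod_i (buyer_gain M1 i + exante (fun i v => 0 + (- K / kap) * dl i v) i) =
    \prod_i (buyer_gain M1 i - K).
  by apply: eq_bigr => i _; rewrite e.
by rewrite opprK.
Qed.

Lemma interim_anonymous h s : admissible h -> supp mu s ->
  forall i j, interim h i s = interim h j s.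
Proof.
move=> ah ss; have [adl zdl] := dl0; have af := adm_freeze ss ah.
apply: (gift_line_constant af) => K c c0.
pose C := `|K| * \sum_i `|interim h i s|.
pose g : rule := fun i v => (c + C + K * freeze h s i v) + (- C / kap) * dl i v.
have aK : admissible (fun i v => c + C + K * freeze h s i v).
  by apply: adm_add (adm_cst _ _ _ _) (adm_scale _ af).
exists g.
  split; first by apply: adm_add aK (adm_scale _ adl).
  move=> i; exists (c + C + K * interim h i s).
    rewrite -addrA addr_ge0//.
    have : - (K * interim h i s) <= C; last by lra.
    rewrite (le_trans (ler_norm _))// normrN normrM ler_wpM2l//.
    by rewrite (bigD1 i)//= lerDl sumr_ge0.
  move=> t st; rewrite /g (interimD _ st aK (adm_scale _ adl)).
  rewrite (interimZ _ _ st adl) zdl// mulr0 addr0.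
  rewrite (interimD _ st (adm_cst _ _ _ _) (adm_scale _ af)) interim_cst.
  by rewrite (interimZ _ _ st af) interim_freeze.
move=> i; rewrite /g (exanteD i aK (adm_scale _ adl)) (exanteZ _ _ adl).
rewrite (lump_exante _ _ _ af) (costless_constant dl0 i i0) divfK//.
ring.
Qed.

(** By anonymity the truncated surplus has the same interim values as [psi] of the own type, so
    their difference is costless and its ex-ante value is common to the buyers. That of [psi] is
    common by equality of laws, and the truncation is removed in the limit. *)
Lemma lump_line_util_equal i j : buyer_gain M i = buyer_gain M j.
Proof.
have ag := surplusM_adm.
have E m : exante (trunc (Hs m) (surplus M)) i = exante (trunc (Hs m) (surplus M)) j.
  set H := Hs m; have sH := supp_Hs m; rewrite -/H in sH.
  have vH := supp_ge sH.
  have sv t : vL <= t -> t <= H -> supp mu t by move=> ? ?; exact: supp_itv sH _ _.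
  pose psi x := below H x * G i0 (clamp vL H x).
  have mpsi : measurable_fun setT psi.
    apply: measurable_funM; first exact: below_measurable.
    apply: clamp_measurable => // s t vs st tH.
    have vt := le_trans vs st; have sH' := le_trans st tH.
    by apply: interim_surplus_mono => //; exact: sv.
  have psib x : `|psi x| <= `|G i0 vL| + `|G i0 H|.
    rewrite /psi normrM -[leRHS]mul1r; apply: ler_pM => //; first exact: below_norm.
    have /andP[c1 c2] := clamp_bounds x vH.
    have sc := sv _ c1 c2.
    have g1 := interim_surplus_mono i0 supp_vL sc c1.
    have g2 := interim_surplus_mono i0 sc sH c2.
    have := ler_norm (- G i0 vL); have := ler_norm (G i0 H); rewrite normrN.
    have := normr_ge0 (G i0 vL); have := normr_ge0 (G i0 H).
    by rewrite ler_norml => *; apply/andP; split; lra.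
  have apsi := adm_weight mV mpsi psib (adm_cst P V mu 1).
  have at_ := adm_trunc H ag.
  have cz : costless (fun i v => trunc H (surplus M) i v - psi (v i) * 1).
    split; first exact: adm_sub.
    move=> k t st; rewrite (interimB _ st at_ apsi).
    rewrite (interim_weight _ _ st ag) (interim_weight _ _ st (adm_cst P V mu 1)).
    rewrite interim_cst mulr1 /psi /below; case: (leP t H) => tH; last by rewrite !mul0r subrr.
    by rewrite !mul1r clamp_id ?supp_ge// (interim_anonymous ag st k i0) subrr.
  have := costless_constant cz i j.
  rewrite !(exanteB _ at_ apsi).
  have epsi k : exante (fun i v => psi (v i) * 1) k = \int[mu]_x psi x.
    rewrite -(esp_law (mV k) (lawV k) mpsi psib).
    by apply: eq_esp => w; rewrite mulr1.
  by rewrite !epsi => /addIr.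
have li := exante_trunc_cvg (i := i) ag; have lj := exante_trunc_cvg (i := j) ag.
rewrite (funext E) in li.
exact: norm_cvg_unique li lj.
Qed.

(** If the common gain were at most 0, so would be its n-th power, n being odd; a positive product
    would then require a negative revenue, and welfare would be negative. *)
Lemma lump_line_positive : 0 < seller_rev M /\ forall i, 0 < buyer_gain M i.
Proof.
have uE i : buyer_gain M i = buyer_gain M i0 by exact: lump_line_util_equal.
have W := welfare_ge0 MfrakM.
have := objective_gt0; rewrite /B (eq_bigr (fun=> buyer_gain M i0)) => [|i _]; last exact: uE.
rewrite prodr_const card_ord => obj.
have on := lump_line_odd.
have W' : 0 <= seller_rev M + n%:R * buyer_gain M i0.
  move: W; rewrite (eq_bigr (fun=> buyer_gain M i0)) => [|i _]; last exact: uE.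
  by rewrite sumr_const card_ord mulr_natl.
have u0 : 0 < buyer_gain M i0.
  rewrite ltNge; apply/negP => u0.
  have r0 : seller_rev M < 0.
    rewrite ltNge; apply/negP => r0; move: obj; rewrite ltNge => /negP; apply.
    by rewrite mulr_ge0_le0// exprn_odd_le0.
  have : n%:R * buyer_gain M i0 <= 0 by rewrite mulr_ge0_le0.
  lra.
split; last by move=> i; rewrite uE.
by move: obj; rewrite pmulr_lgt0// exprn_gt0.
Qed.

End LumpLine.

(** * The case where every costless rule has ex-ante value zero *)

Section NoLumpLine.
Hypothesis costless0 : forall f, costless f -> forall i, exante f i = 0.

(* A combination, weighted by functions of the own type, of finitely many rules
   with type-independent interim values makes [h] costless; the weights are small
   when the interim values of [h] are. *)
Lemma exante_trunc_small i : exists2 C, 0 <= C & forall H h eps,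
  supp mu H -> admissible h -> 0 <= eps ->
  (forall l, measurable_fun setT (fun t => interim h l (clamp vL H t))) ->
  (forall l t, supp mu t -> t <= H -> `|interim h l t| <= eps) ->
  - (C * eps) <= exante (trunc H h) i.
Proof.
(* The rules [F j] below realize a finite family spanning all possible vectors of interim values.
   They are fixed before [h], which makes the constant uniform. *)
pose Y : set 'rV[R]_n := [set y | exists h t,
  [/\ admissible h, supp mu t & y = \row_l interim h l t]].
have [m [b [L [Yb bL]]]] := finite_spanning_family Y.
have /choice[F HF] : forall j, exists f, admissible f /\
    forall l t, supp mu t -> interim f l t = b j 0 l.
  move=> j; have [h [t [ah st ->]]] := Yb j.
  exists (freeze h t); split; first exact: adm_freeze.
  by move=> l t' st'; rewrite interim_freeze mxE.
pose c j := \sum_l `|L l j|.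
have c0 j : 0 <= c j by apply: sumr_ge0.
pose e j := esp P (fun w => `|F j i (prof V w)|).
have e0 j : 0 <= e j by apply: Rintegral_ge0.
exists (\sum_j c j * e j); first by apply: sumr_ge0 => j _; rewrite mulr_ge0.
move=> H h eps sH ah eps0 mh heps.
have vH := supp_ge sH.
have sv t : supp mu (clamp vL H t).
  by have /andP[? ?] := clamp_bounds t vH; exact: supp_itv sH _ _.
(* The coefficient of [F j] that reproduces the interim values of [h] at own type [x]. *)
pose zeta j x := below H x * \sum_l interim h l (clamp vL H x) * L l j.
have mz j : measurable_fun setT (zeta j).
  apply: measurable_funM; first exact: below_measurable.
  by apply: measurable_sum => l; exact: measurable_funM.
have zb j x : `|zeta j x| <= c j * eps.
  rewrite normrM -[leRHS]mul1r; apply: ler_pM => //; first exact: below_norm.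
  rewrite (le_trans (ler_norm_sum _ _ _))// mulr_suml; apply: ler_sum => l _.
  rewrite normrM mulrC; apply: ler_wpM2l => //; apply: heps => //.
  by have /andP[] := clamp_bounds x vH.
have aF j : admissible (F j) by case: (HF j).
have aw j : admissible (fun i v => zeta j (v i) * F j i v).
  exact: adm_weight mV (mz j) (zb j) (aF j).
have at_ := adm_trunc H ah.
have asum : admissible (fun i v => \sum_(j <- index_enum 'I_m) zeta j (v i) * F j i v).
  exact: adm_sum.
have cz : costless (fun i v => trunc H h i v -
    \sum_(j <- index_enum 'I_m) zeta j (v i) * F j i v).
  split; first exact: adm_sub.
  move=> k t st; rewrite (interimB _ st at_ asum) (interim_weight _ _ st ah).
  rewrite (interim_sum _ _ st aw).
  under eq_bigr do rewrite (interim_weight _ _ st (aF _)) (HF _).2// /zeta -mulrA.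
  rewrite -mulr_sumr -mulrBr /below; case: (leP t H) => tH; last by rewrite mul0r.
  rewrite mul1r clamp_id ?supp_ge//.
  have Yt : Y (\row_l interim h l t) by exists h, t.
  have := bL _ Yt k; rewrite mxE => ->; apply/eqP; rewrite subr_eq0; apply/eqP.
  by apply: eq_bigr => j _; congr (_ * _); apply: eq_bigr => l _; rewrite mxE.
(* Ex ante the truncated [h] now equals the weighted combination of the [F j], which is estimated
   term by term. *)
have := costless0 cz i; rewrite (exanteB _ at_ asum) (exante_sum _ _ aw) => /subr0_eq ->.
rewrite mulr_suml -sumrN; apply: ler_sum => j _.
have [_ w2 _] := aw j; have [_ F2 _] := aF j.
rewrite lerNl; apply: le_trans (ler_norm _) _; rewrite normrN.
apply: le_trans (le_normr_Rintegral measurableT (w2 i)) _.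
rewrite mulrAC -espZ; last exact: integrable_norm (F2 i).
apply: le_esp => [||w]; [exact: integrable_norm (w2 i)|exact: srvZ (integrable_norm (F2 i))|].
by rewrite normrM; apply: ler_wpM2r.
Qed.

(** A Riemann sum [S] of frozen allocations is subtracted from the surplus in excess of the one
    frozen at [vL]. The difference has interim values between 0 and [2 * D] up to [H], so its
    truncated ex-ante value is nearly nonnegative; [S] is nonnegative because allocations are. Then
    the mesh is refined. *)
Lemma trunc_surplus_ge0 H i : supp mu H ->
  0 <= exante (trunc H (fun i v => surplus M i v - freeze (surplus M) vL i v)) i.
Proof.
move=> sH; have vH := supp_ge sH.
have [C C0 HC] := exante_trunc_small i.
have sv t : vL <= t -> t <= H -> supp mu t by move=> ? ?; exact: supp_itv sH _ _.
move: (MfrakM) => /(frakMP Vsupp _)[fM aM _ _ _].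
have ag := surplusM_adm; have ag0 := adm_freeze supp_vL ag.
have aB := adm_sub ag ag0.
set f := fun i v => _ - _; set x := exante _ i.
suff key (N : nat) : (0 < N)%N -> - (C * (2 * ((H - vL) / N%:R))) <= x.
  rewrite leNgt; apply/negP => x0.
  (* More than [q] cells make the error smaller than [- x]. *)
  pose q := C * (2 * (H - vL)) / (- x).
  have q0 : 0 <= q.
    by rewrite divr_ge0 ?oppr_ge0 ?(ltW x0)// !mulr_ge0 ?subr_ge0.
  have := key (Num.truncn q).+1 isT.
  have := truncnS_gt q; set N := (Num.truncn q).+1 => qN.
  have N0 : 0 < N%:R :> R by rewrite ltr0n.
  apply/negP; rewrite -ltNge.
  rewrite ltrNr (_ : _ * _ = C * (2 * (H - vL)) / N%:R); last by field; rewrite gt_eqF.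
  rewrite ltr_pdivrMr// -ltr_pdivrMl ?oppr_gt0//.
  by rewrite mulrC.
move=> N0; set D := (H - vL) / N%:R.
have N0' : 0 < N%:R :> R by rewrite ltr0n.
have D0 : 0 <= D by rewrite divr_ge0 ?subr_ge0// ltW.
have sk (k : 'I_N) : supp mu (vL + k%:R * D).
  apply: sv; first by rewrite lerDl mulr_ge0.
  rewrite -lerBrDl; apply: (@le_trans _ _ (N%:R * D)).
    by apply: ler_wpM2r => //; rewrite ler_nat ltnW.
  by rewrite /D mulrC divfK// gt_eqF.
(* The width of the k-th cell, counted from its right endpoint on; the allocation is frozen at its
   left endpoint. *)
pose chi (k : 'I_N) t : R := D * (vL + k.+1%:R * D <= t)%R%:R.
have chi_mono k s t : s <= t -> chi k s <= chi k t.
  move=> st; rewrite ler_wpM2l// ler_nat; case: (leP _ s) => // h.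
  by rewrite (le_trans h st).
have mchi k : measurable_fun setT (chi k).
  by apply: nondecreasing_measurable => // s t st; exact: chi_mono.
have chi0 k t : 0 <= chi k t by rewrite mulr_ge0.
have chib k t : `|chi k t| <= D.
  by rewrite ger0_norm// /chi -[leRHS]mulr1 ler_wpM2l// lern1 leq_b1.
have aw k : admissible (fun i v => chi k (v i) * freeze (alloc M) (vL + k%:R * D) i v).
  exact: adm_weight mV (mchi k) (chib k) (adm_freeze (sk k) aM).
pose S : rule := fun i v =>
  \sum_(k <- index_enum 'I_N) chi k (v i) * freeze (alloc M) (vL + k%:R * D) i v.
have aS : admissible S by exact: adm_sum.
have ah := adm_sub aB aS.
have intE l t : supp mu t -> interim (fun i v => f i v - S i v) l t =
    G l t - G l vL - \sum_(k < N) chi k t * A l (vL + k%:R * D).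
  move=> st; rewrite (interimB _ st aB aS) (interimB _ st ag ag0) interim_freeze.
  congr (_ - _ - _); rewrite (interim_sum _ _ st aw).
  by apply: eq_bigr => k _; rewrite (interim_weight _ _ st (adm_freeze (sk k) aM)) interim_freeze.
have small : - (C * (2 * D)) <= exante (trunc H (fun i v => f i v - S i v)) i.
  apply: HC => //; first by rewrite mulr_ge0.
    have svc t : supp mu (clamp vL H t).
      by have /andP[? ?] := clamp_bounds t vH; exact: sv.
    move=> l; rewrite (funext (fun t => intE l _ (svc t))).
    apply: measurable_funB.
      apply: measurable_funB => //.
      apply: clamp_measurable => // s t vs st tH; apply: interim_surplus_mono => //.
        by apply: sv => //; exact: le_trans tH.
      by apply: sv => //; exact: le_trans st.
    apply: measurable_sum => k; apply: measurable_funM => //.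
    by apply: clamp_measurable => // s t _ st _; exact: chi_mono.
  move=> l t st tH; rewrite intE//.
  have /andP[g0 g2] := @grid_envelope R (G l) (A l) vL H N N0 vH
    (fun s t vs st tH => interim_slope l (sv s vs (le_trans st tH)) (sv t (le_trans vs st) tH))
    (fun t vt tH => interim_alloc_bounds l (sv t vt tH)) t (supp_ge st) tH.
  by rewrite ger0_norm.
apply: le_trans small _; rewrite /x /exante.
have [_ t1 _] := adm_trunc H ah; have [_ t2 _] := adm_trunc H aB.
apply: ae_le_esp => //.
have : {ae P, forall w, forall k : 'I_N, forall j, supp mu (upd (prof V w) i (vL + k%:R * D) j)}.
  by apply: filterS Vsupp => w sw k j; rewrite /upd; case: ifP => // _; exact: sw.
apply: filterS => w sw.
rewrite /trunc; apply: ler_wpM2l; first by have /andP[] := below01 H (prof V w i).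
rewrite lerBlDr lerDl; apply: sumr_ge0 => k _; apply: mulr_ge0 => //.
by have /andP[] := feasible_le1 fM (sw k) i.
Qed.

(** Each gain is at least the interim utility at [vL], which is nonnegative by interim rationality;
    a positive product then makes every factor positive. *)
Lemma no_lump_line_positive : 0 < seller_rev M /\ forall i, 0 < buyer_gain M i.
Proof.
have ag := surplusM_adm; have ag0 := adm_freeze supp_vL ag.
move: (MfrakM) => /(frakMP Vsupp _)[fM aM pM _ iM].
have u0 i : 0 <= buyer_gain M i.
  have lim := exante_trunc_cvg (i := i) (adm_sub ag ag0).
  have : 0 <= exante (fun i v => surplus M i v - freeze (surplus M) vL i v) i.
    rewrite -(cvg_lim _ lim)//; apply: limr_ge; first by apply/cvg_ex; eexists; exact: lim.
    by apply: nearW => m; exact: trunc_surplus_ge0.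
  rewrite (exanteB _ ag ag0) exante_freeze subr_ge0; apply: le_trans.
  by rewrite (interim_surplus _ aM pM supp_vL); exact: iM.
have obj := objective_gt0.
have pr0 : 0 < \prod_i buyer_gain M i.
  rewrite lt_def prodr_ge0 ?andbT//.
  by apply: contraTneq obj => e; rewrite /B e mulr0 ltxx.
split; first by move: obj; rewrite /B pmulr_lgt0.
move=> i; rewrite lt_def u0 andbT.
by apply: contraTneq pr0 => e; rewrite (bigD1 i)//= e mul0r ltxx.
Qed.

End NoLumpLine.

Lemma nash_positive : 0 < seller_rev M /\ forall i, 0 < buyer_gain M i.
Proof.
have [[dl [i [cd nz]]]|none] := pselect (exists dl i, costless dl /\ exante dl i != 0).
  exact: lump_line_positive cd nz.
apply: no_lump_line_positive => f cf i; apply/eqP/negPn/negP => nz.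
by apply: none; exists f, i.
Qed.

End NashPositivity.

(** * The efficient allocation *)

Section Efficient.
Context (R : realType) (n : nat).
Implicit Types (v : 'I_n -> R).

Definition top_value v : R := \big[Num.max/0]_(i < n) v i.

Lemma top_value_ge0 v : 0 <= top_value v.
Proof. by rewrite /top_value bigmax_idl le_max lexx. Qed.

Lemma top_value_ge v i : v i <= top_value v.
Proof. exact: le_bigmax. Qed.

Lemma top_value_le v x : 0 <= x -> (forall i, v i <= x) -> top_value v <= x.
Proof. by move=> x0 vx; apply: bigmax_le. Qed.

Lemma top_value_attained v : top_value v = 0 \/ exists i, top_value v = v i.
Proof.
rewrite /top_value; elim/big_ind: _ => [|x y [->|[i ->]] [->|[j ->]]|i _].
- by left.
- by left; rewrite maxxx.
- by case: leP => _; [right; exists j|left].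
- by case: leP => _; [left|right; exists i].
- by case: leP => _; right; [exists j|exists i].
- by right; exists i.
Qed.

Lemma top_value_perm v (s : {perm 'I_n}) : top_value (fun j => v (s j)) = top_value v.
Proof.
apply/eqP; rewrite eq_le; apply/andP; split.
  by apply: top_value_le => [|i]; [exact: top_value_ge0|exact: (top_value_ge v (s i))].
apply: top_value_le => [|i]; first exact: top_value_ge0.
by rewrite -[i](permKV s); exact: (top_value_ge (fun j => v (s j))).
Qed.

Lemma top_value_upd_le v i t : 0 <= t -> top_value (upd v i t) <= t + top_value v.
Proof.
move=> t0; apply: top_value_le => [|j]; first by rewrite addr_ge0// top_value_ge0.
rewrite /upd; case: eqP => _; first by rewrite lerDl top_value_ge0.
by rewrite -[leLHS]add0r lerD// top_value_ge.
Qed.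

Lemma top_value_upd_mono v i s t : s <= t -> top_value (upd v i s) <= top_value (upd v i t).
Proof.
move=> st; apply: top_value_le => [|j]; first exact: top_value_ge0.
apply: le_trans (top_value_ge _ j); rewrite /upd; by case: eqP.
Qed.

(** Fix a buyer attaining the maximum: the n - 1 terms in which another buyer is removed still reach
    it. *)
Lemma sum_top_value_without v :
  (n%:R - 1) * top_value v <= \sum_i top_value (upd v i 0).
Proof.
have [v0|[j vj]] := top_value_attained v.
  by rewrite v0 mulr0 sumr_ge0// => i _; exact: top_value_ge0.
have : \sum_(i < n) (top_value v * (i != j)%:R) <= \sum_i top_value (upd v i 0).
  apply: ler_sum => i _; case: eqP => /= [_|/eqP ij]; first by rewrite mulr0 top_value_ge0.
  rewrite mulr1 vj; apply: le_trans (top_value_ge _ j).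
  by rewrite /upd eq_sym (negbTE ij).
apply: le_trans; rewrite -mulr_sumr mulrC; apply: ler_wpM2l; first exact: top_value_ge0.
rewrite (bigD1 j)//= eqxx add0r (eq_bigr (fun=> 1)); last by move=> i ->.
rewrite sumr_const cardC1 card_ord -[X in _ <= _ *+ X]subn1 natrB//.
exact: leq_ltn_trans (ltn_ord j).
Qed.

(** This can be zero: [top_value] is at least 0, so nobody attains it when all values are
    negative. *)
Definition winners v : R := \sum_(j < n) (v j == top_value v)%:R.

(* The [Num.max 1] is inert whenever somebody wins. *)
Definition win i v : R := (v i == top_value v)%:R * (Num.max 1 (winners v))^-1.

Lemma win_ge0 i v : 0 <= win i v.
Proof. by rewrite mulr_ge0// invr_ge0 le_max ler01. Qed.

Lemma sum_winE v : \sum_i win i v = winners v * (Num.max 1 (winners v))^-1.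
Proof. by rewrite -mulr_suml. Qed.

Lemma sum_win_le1 v : \sum_i win i v <= 1.
Proof.
rewrite sum_winE ler_pdivrMr; first by rewrite mul1r le_max lexx orbT.
by rewrite lt_max ltr01.
Qed.

Lemma win_value i v : v i * win i v = top_value v * win i v.
Proof. by rewrite /win; case: eqP => [->//|_]; rewrite !mul0r !mulr0. Qed.

Lemma sum_win_value v : \sum_i v i * win i v = top_value v.
Proof.
under eq_bigr do rewrite win_value.
rewrite -mulr_sumr sum_winE.
have [->|[j vj]] := top_value_attained v; first by rewrite mul0r.
have w1 : 1 <= winners v.
  rewrite /winners (bigD1 j)//= vj eqxx lerDl; apply: sumr_ge0 => i _; exact: ler0n.
by rewrite max_r// divff ?mulr1// gt_eqF// (lt_le_trans ltr01).
Qed.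

Lemma win_perm i v (s : {perm 'I_n}) : win i (fun j => v (s j)) = win (s i) v.
Proof.
rewrite /win /winners top_value_perm; congr (_ * (Num.max _ _)^-1).
by rewrite [RHS](reindex_inj (@perm_inj _ s)).
Qed.

(** The Groves argument: the left side is the welfare, at true type [t], of the allocation chosen
    under the report [t'], which cannot exceed the maximal welfare. *)
Lemma win_deviation i v t t' :
  t * win i (upd v i t') + top_value (upd v i t') * (1 - win i (upd v i t')) <=
  top_value (upd v i t).
Proof.
set v' := upd v i t'; set b := top_value (upd v i t).
have -> : top_value v' * (1 - win i v') = \sum_(j | j != i) v' j * win j v'.
  rewrite mulrBr mulr1 -win_value -{1}(sum_win_value v') (bigD1 i)//=; ring.
apply: (@le_trans _ _ (\sum_j b * win j v')); last first.
  by rewrite -mulr_sumr -[leRHS]mulr1; apply: ler_wpM2l; [exact: top_value_ge0|exact: sum_win_le1].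
rewrite [leRHS](bigD1 i)//=; apply: lerD.
  by apply: ler_wpM2r; [exact: win_ge0|rewrite -{1}(updE v i t); exact: top_value_ge].
apply: ler_sum => j ji; apply: ler_wpM2r; first exact: win_ge0.
by apply: le_trans (top_value_ge _ j); rewrite /v' /upd (negbTE ji).
Qed.

Context (d : measure_display) (Omega : measurableType d).

Lemma measurable_bool_real (b : Omega -> bool) : measurable_fun setT b ->
  measurable_fun setT (fun w => (b w)%:R : R).
Proof.
move=> mb; rewrite (_ : (fun w => _) = (fun w => if b w then 1 else 0 : R)); last first.
  by apply/funext => w; case: (b w).
by apply: measurable_fun_if.
Qed.

Lemma measurable_top_value (W : Omega -> 'I_n -> R) :
  (forall j, measurable_fun setT (fun w => W w j)) ->
  measurable_fun setT (fun w => top_value (W w)).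
Proof.
move=> mW; rewrite /top_value; elim: (index_enum _) => [|i s IH].
  by under eq_fun do rewrite big_nil; exact: measurable_cst.
under eq_fun do rewrite big_cons.
exact: measurable_maxr.
Qed.

Lemma measurable_win i (W : Omega -> 'I_n -> R) :
  (forall j, measurable_fun setT (fun w => W w j)) ->
  measurable_fun setT (fun w => win i (W w)).
Proof.
move=> mW; have mT := measurable_top_value mW.
apply: measurable_funM; first by apply/measurable_bool_real/measurable_fun_eqr.
have minv : measurable_fun setT (fun x : R => (Num.max 1 x)^-1).
  apply: nonincreasing_measurable => // x y xy.
  rewrite lef_pV2 ?posrE ?lt_max ?ltr01//.
  by rewrite ge_max !le_max lexx xy orbT.
apply: (measurableT_comp minv); apply: measurable_sum => j.
by apply/measurable_bool_real/measurable_fun_eqr.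
Qed.

End Efficient.

(** * Posted prices and the Groves mechanism *)

Section Mechanisms.
Context (R : realType) (d : measure_display) (Omega : measurableType d).
Context (P : probability Omega R) (n : nat) (V : 'I_n -> Omega -> R).
Context (mu : probability R R).
Hypothesis n_gt0 : (0 < n)%N.
Hypothesis iidV : iid_values P V mu.
Hypothesis Vsupp : {ae P, forall w, forall i, supp mu (V i w)}.
Hypothesis supp_ge0 : forall t, supp mu t -> 0 <= t.

Local Notation admissible := (admissible P V mu).
Local Notation interim := (interim P V).
Local Notation exante := (exante P V).
Local Notation frakM := (in_frakM P V mu).
Local Notation seller_rev := (seller_rev P V).
Local Notation buyer_gain := (buyer_gain P V).

Let mV i : measurable_fun setT (V i). Proof. by case: iidV. Qed.
Let lawV i (B : set R) : measurable B -> P (V i @^-1` B) = mu B.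
Proof. by case: iidV => _ + _; exact. Qed.

Let nR_gt0 : 0 < n%:R :> R. Proof. by rewrite ltr0n. Qed.

Lemma Vge0 : {ae P, forall w, forall i, 0 <= V i w}.
Proof. by apply: filterS Vsupp => w sw i; exact: supp_ge0. Qed.

Lemma adm_own (phi : R -> R) C : measurable_fun setT phi ->
  (forall x, `|phi x| <= C) -> admissible (fun i v => phi (v i)).
Proof.
move=> mphi phiC; split=> // [i|i t st].
- apply: (@srv_dominated _ _ _ P _ (fun=> C)); last exact: aeW.
  + exact: (measurableT_comp mphi (mV i)).
  + exact: srv_cst.
- by apply: srv_eq (srv_cst P (phi t)) => w; rewrite updE.
Qed.

Lemma interim_own (phi : R -> R) i t : interim (fun i v => phi (v i)) i t = phi t.
Proof. by rewrite -[RHS](esp_cst P); apply: eq_esp => w; rewrite updE. Qed.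

Definition above (p x : R) : R := (p <= x)%R%:R.

Lemma above_measurable p : measurable_fun setT (above p).
Proof.
apply: nondecreasing_measurable => // x y xy; rewrite /above.
by case: (leP p x) => // px; rewrite (le_trans px xy).
Qed.

Lemma above01 p x : 0 <= above p x <= 1.
Proof. by rewrite /above; case: (p <= x); rewrite ?lexx ?ler01. Qed.

(* A buyer drawn uniformly at random is offered the price [p]. *)
Definition posted (p : R) : mechanism R n :=
  Mechanism (fun i v => n%:R^-1 * above p (v i)) (fun i v => p * (n%:R^-1 * above p (v i))).

Lemma posted_alloc_adm p : admissible (alloc (posted p)).
Proof.
apply: (@adm_own (fun x => n%:R^-1 * above p x) n%:R^-1).
- by apply: measurable_funM => //; exact: above_measurable.
- move=> x; have /andP[a0 a1] := above01 p x.
  rewrite ger0_norm; last by rewrite mulr_ge0// invr_ge0 ler0n.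
  by rewrite -[leRHS]mulr1 ler_wpM2l// invr_ge0 ler0n.
Qed.

Lemma posted_frakM p : frakM (posted p).
Proof.
have aM := posted_alloc_adm p.
have iE i t : interim (alloc (posted p)) i t = n%:R^-1 * above p t.
  exact: (interim_own (fun x => n%:R^-1 * above p x)).
have pE i t : interim (pay (posted p)) i t = p * (n%:R^-1 * above p t).
  exact: (interim_own (fun x => p * (n%:R^-1 * above p x))).
have key s t : (t - p) * above p s <= (t - p) * above p t /\ 0 <= (t - p) * above p t.
  by rewrite /above; case: (leP p s) => _; case: (leP p t) => pt; rewrite ?mulr0 ?mulr1; split; lra.
have in0 : 0 <= n%:R^-1 :> R by rewrite invr_ge0 ltW.
apply/(frakMP Vsupp _); split=> //.
- move=> v sv; split=> [i|].
    by have /andP[? ?] := above01 p (v i); rewrite /= mulr_ge0.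
  apply: (@le_trans _ _ (\sum_(i < n) n%:R^-1)).
    apply: ler_sum => i _; have /andP[? ?] := above01 p (v i).
    by rewrite /= -[leRHS]mulr1 ler_wpM2l.
  by rewrite sumr_const card_ord -[_ *+ n]mulr_natl divff// gt_eqF.
- exact: adm_scale.
- move=> i t t' st st'; rewrite !iE !pE.
  have [k _] := key t' t; have := ler_wpM2l in0 k; lra.
- move=> i t st; rewrite iE pE.
  have [_ k] := key t t; have := mulr_ge0 in0 k; lra.
Qed.

Lemma prob_above_esp q i :
  esp P (fun w => (q < V i w)%R%:R) = fine (mu [set x | q < x]).
Proof.
have mA : measurable [set x : R | q < x].
  by rewrite -set_itvoy; exact: measurable_itv.
rewrite -(lawV i mA) /esp /Rintegral; congr fine.
have mVA : measurable (V i @^-1` [set x | q < x]).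
  by rewrite -[X in measurable X]setTI; exact: mV.
rewrite -[X in P X]setIT -integral_indic//.
by apply: eq_integral => w _; rewrite indicE mem_setE.
Qed.

Lemma prob_above_srv q i : summable_rv P (fun w => (q < V i w)%R%:R).
Proof.
apply: (@srv_dominated _ _ _ P _ (fun=> 1)); [|exact: srv_cst|].
  by apply/measurable_bool_real/measurable_fun_ltr.
by apply: aeW => w; rewrite ger0_norm// lern1 leq_b1.
Qed.

Section PostedPositive.
Context (p : R).
Hypothesis p0 : 0 < p.
Hypothesis pmu : (0 < mu [set x | (2 * p < x)%R])%E.

Let fpmu : 0 < fine (mu [set x | 2 * p < x]).
Proof.
rewrite fine_gt0// pmu/=; apply: le_lt_trans (ltry 1); apply: probability_le1.
by rewrite -set_itvoy; exact: measurable_itv.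
Qed.

Let ipn : 0 < n%:R^-1 * p.
Proof. by rewrite mulr_gt0 ?invr_gt0. Qed.

(** Values above [2 * p] have positive probability; there the payment is [p / n] and the gain
    exceeds [p / n]. *)
Let lower i (g : Omega -> R) : summable_rv P g ->
  (forall w, n%:R^-1 * p * (2 * p < V i w)%R%:R <= g w) -> 0 < esp P g.
Proof.
move=> sg lg; apply: lt_le_trans (le_esp (srvZ _ (prob_above_srv (2 * p) i)) sg lg).
by rewrite espZ ?prob_above_esp; [exact: mulr_gt0|exact: prob_above_srv].
Qed.

Lemma posted_pay_gt0 i : 0 < exante (pay (posted p)) i.
Proof.
have [_ a2 _] := posted_alloc_adm p.
apply: (@lower i); first exact: srvZ (a2 i).
move=> w; rewrite /= mulrCA mulrA; apply: ler_wpM2l; first exact: ltW.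
rewrite /above /prof ler_nat; case: (ltP (2 * p) (V i w)) => // h.
by case: (leP p (V i w)) => // h2; exfalso; move: h h2 (p0); lra.
Qed.

Lemma posted_rev_gt0 : 0 < seller_rev (posted p).
Proof.
rewrite /seller_rev (bigD1 (Ordinal n_gt0))//= ltr_pwDl//; first exact: posted_pay_gt0.
by apply: sumr_ge0 => i _; exact: ltW (posted_pay_gt0 i).
Qed.

Lemma posted_util_gt0 i : (forall i, summable_rv P (V i)) -> 0 < buyer_gain (posted p) i.
Proof.
move=> sV; apply: (@lower i).
  have [fM aM pM _ _] := (frakMP Vsupp _).1 (posted_frakM p).
  by have [_ + _] := surplus_adm mV Vsupp Vge0 sV fM aM pM; apply.
move=> w; rewrite /surplus /= /above /prof.
rewrite (_ : _ - _ = n%:R^-1 * ((V i w - p) * (p <= V i w)%R%:R)); last by ring.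
rewrite -mulrA; apply: ler_wpM2l; first by rewrite invr_ge0 ltW.
have p0' := p0; case: (ltP (2 * p) (V i w)) => h; case: (leP p (V i w)) => h2 /=; lra.
Qed.

End PostedPositive.

(** * The Groves mechanism with zero expected revenue *)

Section Groves.
Hypothesis sT : summable_rv P (fun w => top_value (prof V w)).

Let T := esp P (fun w => top_value (prof V w)).
Let c := (n%:R - 1) / n%:R * T.

(* Everybody receives the value of the others against a fee making the total revenue vanish. *)
Definition groves : mechanism R n :=
  Mechanism (@win R n) (fun i v => c - (top_value v - top_value v * win i v)).

Let mupd i t j : measurable_fun setT (fun w => upd (prof V w) i t j).
Proof.
rewrite /upd; case: (j == i); first exact: measurable_cst.
exact: mV.
Qed.

Let mprof j : measurable_fun setT (fun w => prof V w j).
Proof. exact: mV. Qed.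

Lemma win_feasible : ex_post_feasible mu groves.
Proof. by move=> v _; split=> [i|]; [exact: win_ge0|exact: sum_win_le1]. Qed.

Lemma win_adm : admissible (@win R n).
Proof.
apply: (feasible_adm Vsupp win_feasible) => [i|i t st|s v i] /=.
- exact: measurable_win.
- exact: measurable_win.
- exact: win_perm.
Qed.

Lemma top_value_adm : admissible (fun _ v => top_value v).
Proof.
split=> [s v _|_|i t st]; [exact: top_value_perm|exact: sT|].
apply: (srv_dominated _ (srvD (srv_cst P t) sT)); first exact: measurable_top_value.
by apply: aeW => w; rewrite ger0_norm ?top_value_ge0// top_value_upd_le// supp_ge0.
Qed.

Let win_le1 i (v : 'I_n -> R) : win i v <= 1.
Proof.
apply: le_trans (sum_win_le1 v); rewrite (bigD1 i)//= lerDl.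
by apply: sumr_ge0 => j _; exact: win_ge0.
Qed.

Let prize_le i (v : 'I_n -> R) : `|top_value v * win i v| <= top_value v.
Proof.
rewrite ger0_norm; last by apply: mulr_ge0; [exact: top_value_ge0|exact: win_ge0].
by rewrite -[leRHS]mulr1; apply: ler_wpM2l; [exact: top_value_ge0|exact: win_le1].
Qed.

Lemma prize_adm : admissible (fun i v => top_value v * win i v).
Proof.
have [t1 t2 t3] := top_value_adm; have [w1 w2 w3] := win_adm.
split=> [s v i|i|i t st]; first by rewrite top_value_perm win_perm.
- apply: (srv_dominated _ (t2 i)); last by apply: aeW => w; exact: prize_le.
  by apply: measurable_funM; [exact: measurable_top_value|exact: measurable_win].
- apply: (srv_dominated _ (t3 i t st)); last by apply: aeW => w; exact: prize_le.
  by apply: measurable_funM; [exact: measurable_top_value|exact: measurable_win].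
Qed.

Lemma groves_pay_adm : admissible (pay groves).
Proof. exact: adm_sub (adm_cst _ _ _ _) (adm_sub top_value_adm prize_adm). Qed.

Definition others_top i := esp P (fun w => top_value (upd (prof V w) i 0)).

Lemma others_top_srv i : summable_rv P (fun w => top_value (upd (prof V w) i 0)).
Proof.
apply: (srv_dominated _ (srvD (srv_cst P 0) sT)); first exact: measurable_top_value.
by apply: aeW => w; rewrite ger0_norm ?top_value_ge0// top_value_upd_le.
Qed.

Lemma others_top_ccdf i r : 0 <= r ->
  P [set w | top_value (upd (prof V w) i 0) <= r] =
  (\prod_(k < n) (if k == i then 1 else mu `]-oo, r]%classic))%E.
Proof.
move=> r0; have [_ _ indep] := iidV.
pose C (k : 'I_n) : set R := if k == i then setT else `]-oo, r]%classic.
have mC k : measurable (C k) by rewrite /C; case: eqP.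
rewrite (_ : [set w | _] = \bigcap_(k in [set: 'I_n]) (V k @^-1` C k)).
  rewrite indep//; apply: eq_bigr => k _; rewrite lawV// /C.
  by case: eqP => // _; rewrite probability_setT.
apply/seteqP; split=> w /=.
  move=> h k _ /=; rewrite /C; case: eqP => //= /eqP ki.
  rewrite in_itv/=; apply: le_trans h.
  by apply: le_trans (top_value_ge _ k); rewrite /upd (negbTE ki).
move=> h; apply: top_value_le => // k; rewrite /upd; case: eqP => [//|/eqP ki].
by have := h k I; rewrite /C/= (negbTE ki) /= in_itv.
Qed.

(** Independence is given on rectangles, so the expectations are written as integrals of tails. Each
    distribution function is a product with one factor replaced by 1, and the transposition of [i]
    and [j] matches the two products. *)
Lemma others_topE i j : others_top i = others_top j.
Proof.
have E k : (others_top k)%:E = (\int[lebesgue_measure]_(r in `[0%R, +oo[)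
    (1 - P [set w | (top_value (upd (prof V w) k 0) <= r)%R]))%E.
  have mX : measurable_fun setT (fun w => top_value (upd (prof V w) k 0)).
    exact: measurable_top_value.
  pose X : {RV P >-> R} := mfun_Sub (mem_set mX).
  have X0 w : 0 <= X w by exact: top_value_ge0.
  have := ge0_expectation_ccdf X0; rewrite expectation_def.
  rewrite espE ?others_top_srv// => ->.
  apply: eq_integral => r _.
  rewrite -probability_setC; last first.
    rewrite -[X in measurable X]setTI.
    rewrite (_ : [set w | _] = X @^-1` `]-oo, r]%classic).
      exact: (mX measurableT _ (measurable_itv _)).
    by apply/seteqP; split=> w /=; rewrite in_itv.
  rewrite /ccdf /distribution /pushforward; congr (P _).
  by apply/seteqP; split=> w /=; rewrite in_itv/= andbT ltNge => /negP.
apply: EFin_inj; rewrite !E; apply: eq_integral => r; rewrite inE/= in_itv/= andbT => r0.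
congr (1 - _)%E; rewrite !others_top_ccdf//.
rewrite [RHS](reindex_inj (@perm_inj _ (tperm i j))).
apply: eq_bigr => k _; congr (if _ then _ else _).
by rewrite -[X in _ = (_ == X)](tpermL i j) (inj_eq perm_inj).
Qed.

(** The expected maxima of the others sum to at least [(n - 1) * T] and are all equal. This makes
    the fee individually rational. *)
Lemma fee_le i : c <= others_top i.
Proof.
have : (n%:R - 1) * T <= n%:R * others_top i.
  have -> : n%:R * others_top i = \sum_(k < n) others_top k.
    under eq_bigr do rewrite (others_topE _ i).
    by rewrite sumr_const card_ord mulr_natl.
  rewrite -esp_sum; last exact: others_top_srv.
  rewrite -espZ//; apply: le_esp; [exact: srvZ|by apply: srv_sum => k; exact: others_top_srv|].
  by move=> w; exact: sum_top_value_without.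
by rewrite /c mulrAC ler_pdivrMr// [X in _ <= X]mulrC.
Qed.

Let deviation i t t' : supp mu t' ->
  t * interim (alloc groves) i t' - interim (pay groves) i t' =
  esp P (fun w => t * win i (upd (prof V w) i t') +
    top_value (upd (prof V w) i t') * (1 - win i (upd (prof V w) i t'))) - c.
Proof.
move=> st'; have [_ _ w3] := win_adm; have [_ _ t3] := top_value_adm.
have [_ _ p3] := prize_adm; have [_ _ q3] := groves_pay_adm.
rewrite /interim -espZ; last exact: w3.
rewrite -espB; [|exact: srvZ (w3 i t' st')|exact: q3].
rewrite -[c in RHS](esp_cst P) -espB; last exact: srv_cst.
  by apply: eq_esp => w; rewrite /=; ring.
apply: srv_eq (srvD (srvZ t (w3 i t' st')) (srvB (t3 i t' st') (p3 i t' st'))) => w.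
by ring.
Qed.

Let truthful i t : supp mu t ->
  t * interim (alloc groves) i t - interim (pay groves) i t =
  esp P (fun w => top_value (upd (prof V w) i t)) - c.
Proof.
move=> st; rewrite deviation//; congr (_ - _); apply: eq_esp => w.
have := win_value i (upd (prof V w) i t); rewrite updE => ->; ring.
Qed.

Lemma groves_frakM : frakM groves.
Proof.
have [_ _ w3] := win_adm; have [_ _ t3] := top_value_adm; have [_ _ p3] := prize_adm.
apply/(frakMP Vsupp _); split; [exact: win_feasible|exact: win_adm|exact: groves_pay_adm| |].
- move=> i t t' st st'; rewrite truthful// deviation//; apply: lerB => //.
  apply: le_esp; [|exact: t3|by move=> w; exact: win_deviation].
  apply: srv_eq (srvD (srvZ t (w3 i t' st')) (srvB (t3 i t' st') (p3 i t' st'))) => w.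
  by ring.
- move=> i t st; rewrite truthful// subr_ge0; apply: le_trans (fee_le i) _.
  apply: le_esp; [exact: others_top_srv|exact: t3|].
  by move=> w; apply: top_value_upd_mono; exact: supp_ge0.
Qed.

Lemma groves_gain i : buyer_gain groves i = T / n%:R.
Proof.
rewrite /buyer_gain (_ : exante _ i = T - c).
  by rewrite /c; field; rewrite gt_eqF.
rewrite -[c in RHS](esp_cst P) -espB//; last exact: srv_cst.
apply: eq_esp => w; rewrite /surplus/=.
by have := win_value i (prof V w); rewrite /= => ->; ring.
Qed.

Lemma groves_rev : seller_rev groves = 0.
Proof.
have e i : exante (pay groves) i = c - T + exante (fun i v => top_value v * win i v) i.
  have [_ p2 _] := prize_adm.
  rewrite /exante/= espB; [|exact: srv_cst|exact: srvB sT (p2 i)].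
  by rewrite esp_cst espB // -/T; ring.
rewrite /seller_rev; under eq_bigr do rewrite e.
rewrite big_split/= sumr_const card_ord.
have -> : \sum_i exante (fun i v => top_value v * win i v) i = T.
  have [_ p2 _] := prize_adm.
  rewrite /exante -esp_sum; last exact: p2.
  apply: eq_esp => w; rewrite -[RHS](sum_win_value (prof V w)).
  by apply: eq_bigr => i _; rewrite win_value.
rewrite -[_ *+ n]mulr_natl /c; field; rewrite gt_eqF//.
Qed.

End Groves.
End Mechanisms.

(** * The support, and infinite welfare *)

(** A point outside the support has a null neighbourhood, hence lies in a null interval with
    rational endpoints, and there are countably many of these. *)
Lemma off_supp_negligible (R : realType) (mu : probability R R) :
  mu.-negligible (~` supp mu).
Proof.
pose J (q : rat * rat) : set R := `]ratr q.1, ratr q.2[%classic.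
pose F k := if unpickle k is Some q then (if mu (J q) == 0%E then J q else set0) else set0.
apply: (@negligibleS _ _ _ _ (\bigcup_k F k)); last first.
  apply: negligible_bigcup => k; rewrite /F; case: (unpickle k) => [q|]; last first.
    exact: negligible_set0.
  case: eqP => [q0|_]; last exact: negligible_set0.
  by apply/negligibleP => //; exact: measurable_itv.
move=> t /= /existsNP[e /not_implyP[e0 /negP]]; rewrite -leNgt => te.
have [q] : exists q : rat, ratr q \in `]t - e, t[ by apply: rat_in_itvoo; rewrite ltrBlDr ltrDl.
have [r] : exists r : rat, ratr r \in `]t, t + e[ by apply: rat_in_itvoo; rewrite ltrDl.
rewrite !in_itv/= => /andP[r1 r2] /andP[q1 q2].
exists (pickle (q, r)); [exact: I|rewrite /F pickleK].
have -> : mu (J (q, r)) = 0%E.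
  apply/eqP; rewrite eq_le measure_ge0 andbT; apply: le_trans te.
  have mJ : measurable [set x : R | t - e < x /\ x < t + e].
    rewrite (_ : [set x | _] = `]t - e, t + e[%classic); first exact: measurable_itv.
    by apply/seteqP; split=> x /=; rewrite in_itv/= => /andP.
  apply: le_measure; rewrite ?inE//; first exact: measurable_itv.
  by move=> x; rewrite /J /= in_itv/= => /andP[? ?]; split; lra.
by rewrite eqxx /J/= in_itv/= q2 r1.
Qed.

Section ValueSupport.
Context (R : realType) (d : measure_display) (Omega : measurableType d).
Context (P : probability Omega R) (n : nat) (V : 'I_n -> Omega -> R).
Context (mu : probability R R).
Hypothesis iidV : iid_values P V mu.

Let mV i : measurable_fun setT (V i). Proof. by case: iidV. Qed.
Let lawV i (B : set R) : measurable B -> P (V i @^-1` B) = mu B.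
Proof. by case: iidV => _ + _; exact. Qed.

Lemma ae_law (Q : R -> Prop) : mu.-negligible (~` [set x | Q x]) ->
  {ae P, forall w, forall i, Q (V i w)}.
Proof.
move=> [N [mN N0 QN]]; apply: filter_forall => i.
exists (V i @^-1` N); split.
- by rewrite -[X in measurable X]setTI; exact: mV.
- by rewrite -N0 -(lawV i mN).
- by move=> w /= nQ; apply: QN.
Qed.

Lemma values_supp : {ae P, forall w, forall i, supp mu (V i w)}.
Proof. exact: ae_law (off_supp_negligible mu). Qed.

(** The positive half-line is the countable union of the rays beyond [2 / (k + 1)]. *)
Lemma ae_values_le0 : (forall p, 0 < p -> mu [set x | (2 * p < x)%R] = 0%E) ->
  {ae P, forall w, forall i, V i w <= 0}.
Proof.
move=> H; apply: (@ae_law (fun x => x <= 0)).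
apply: (@negligibleS _ _ _ _ (\bigcup_k [set x : R | 2 * k.+1%:R^-1 < x])).
  move=> x /= /negP; rewrite -ltNge => x0.
  exists (Num.truncn (2 / x)) => //=; have := truncnS_gt (2 / x).
  set N := _.+1 => h; have N0 : 0 < N%:R :> R by rewrite ltr0n.
  by rewrite ltr_pdivrMr// mulrC -ltr_pdivrMr.
apply: negligible_bigcup => k; apply/negligibleP; last by apply: H; rewrite invr_gt0.
by rewrite -set_itvoy; exact: measurable_itv.
Qed.

Lemma integral_posv_law i : (\int[P]_w (Num.max 0 (V i w))%:E = \int[mu]_x (Num.max 0 x)%:E)%E.
Proof.
have mf : measurable_fun setT (fun x : R => (Num.max 0 x)%:E).
  by apply/measurable_EFinP; apply: measurable_maxr.
have := @ge0_integral_pushforward _ _ _ _ _ _ (mV i) P setT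
  (fun x => (Num.max 0 x)%:E) measurableT mf.
rewrite preimage_setT => <-; last by move=> x _; rewrite lee_fin le_max lexx.
by apply: eq_measure_integral => A mA _; exact: lawV.
Qed.

End ValueSupport.

Section InfiniteWelfare.
Context (R : realType) (d : measure_display) (Omega : measurableType d).
Context (P : probability Omega R) (n : nat) (V : 'I_n -> Omega -> R).
Context (mu : probability R R).
Hypothesis n_gt0 : (0 < n)%N.
Hypothesis iidV : iid_values P V mu.
Hypothesis supp_ge0 : forall t, supp mu t -> 0 <= t.
Context (p : R).
Hypothesis p0 : 0 < p.
Hypothesis pmu : (0 < mu [set x | (2 * p < x)%R])%E.
Hypothesis optoo : opt P V = +oo%E.

Let mV i : measurable_fun setT (V i). Proof. by case: iidV. Qed.
Let Vsupp := values_supp iidV.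

Local Open Scope ereal_scope.

(** The maximum is at most the sum of the positive parts, so one of them has infinite expectation,
    and by equality of laws all do. *)
Lemma posv_infinite i : \int[P]_w (Num.max 0 (V i w))%:E = +oo.
Proof.
have mX j : measurable_fun setT (fun w => (Num.max 0 (V j w))%:E).
  by apply/measurable_EFinP; apply: measurable_maxr.
have X0 j w : 0 <= (Num.max 0 (V j w))%:E by rewrite lee_fin le_max lexx.
have [//|fin] := eqVneq (\int[P]_w (Num.max 0 (V i w))%:E) +oo.
have : opt P V <= \sum_(j < n) \int[P]_w (Num.max 0 (V j w))%:E.
  rewrite -ge0_integral_sum//; apply: ge0_le_integral => //.
  - by move=> w _; rewrite lee_fin; exact: top_value_ge0.
  - by apply/measurable_EFinP; exact: (measurable_top_value (W := prof V)).
  - exact: emeasurable_sum.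
  move=> w _; rewrite sumEFin lee_fin; apply: top_value_le => [|j].
    by apply: sumr_ge0 => j _; rewrite le_max lexx.
  rewrite (bigD1 j)//=; apply: (@le_trans _ _ (Num.max 0 (V j w))%R).
    by rewrite le_max lexx orbT.
  by rewrite lerDl; apply: sumr_ge0 => k _; rewrite le_max lexx.
rewrite optoo leye_eq esum_eqy => [/existsP[j /eqP]|j _]; last first.
  by rewrite gt_eqF// (lt_le_trans (ltNyr 0))// integral_ge0.
by rewrite !(integral_posv_law iidV) in fin * => /= e; rewrite e eqxx in fin.
Qed.

(** The positive part of the value is at most [p + n * Y], where [Y] is the allocated value, so [Y]
    has infinite expectation while the payment is integrable. *)
Lemma posted_util_infinite i : buyer_util P V (posted n p) i = +oo.
Proof.
have [_ _ [_ p2 _] _ _] := (frakMP Vsupp _).1 (posted_frakM n_gt0 iidV Vsupp p).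
rewrite /buyer_util; suff -> : \int[P]_w (V i w * alloc (posted n p) i (prof V w))%:E = +oo.
  by rewrite espE.
pose Y w := (V i w * alloc (posted n p) i (prof V w))%R.
have mY : measurable_fun setT Y.
  have [_ [_ a2 _] _ _ _] := (frakMP Vsupp _).1 (posted_frakM n_gt0 iidV Vsupp p).
  by apply: measurable_funM => //; exact: srv_measurable (a2 i).
have nR : (0 < n%:R :> R)%R by rewrite ltr0n.
have Y0 w : (0 <= Y w)%R.
  rewrite /Y /= /above /prof; case: (leP p (V i w)) => h; rewrite ?mulr0// mulr1.
  by rewrite mulr_ge0 ?invr_ge0 ?ltW// (lt_le_trans p0).
have := posv_infinite i; have [//|fin] := eqVneq (\int[P]_w (Y w)%:E) +oo.
have : \int[P]_w (Num.max 0 (V i w))%:E <= \int[P]_w (p%:E + n%:R%:E * (Y w)%:E).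
  apply: ge0_le_integral => //.
  - by move=> w _; rewrite lee_fin le_max lexx.
  - by apply/measurable_EFinP; apply: measurable_maxr.
  - by apply/measurable_EFinP; apply: measurable_funD => //; exact: measurable_funM.
  move=> w _; rewrite -EFinM -EFinD lee_fin ge_max; apply/andP; split.
    by apply: addr_ge0; [exact: ltW|apply: mulr_ge0; [exact: ltW|exact: Y0]].
  rewrite /Y /= /above /prof; case: (leP p (V i w)) => h.
    by rewrite mulr1 mulrCA mulfV ?gt_eqF// mulr1 lerDr ltW.
  by rewrite !mulr0 addr0; exact: ltW.
rewrite ge0_integralD//; [|by move=> w _; rewrite lee_fin ltW
  |by move=> w _; rewrite -EFinM lee_fin mulr_ge0// ltW
  |by apply/measurable_EFinP; exact: measurable_funM].
rewrite integral_cst// [X in p%:E * X](@probability_setT _ _ _ P) mule1 ge0_integralZl//; last 2 first.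
- by apply/measurable_EFinP.
- by move=> w _; rewrite lee_fin.
have : \int[P]_w (Y w)%:E \is a fin_num.
  rewrite ge0_fin_numE; first by rewrite ltey.
  by apply: integral_ge0 => w _; rewrite lee_fin; exact: Y0.
by move=> /fineK <- + oo; rewrite oo -EFinM -EFinD.
Qed.

(** The Nash product is infinite at the posted price, hence at [M]. There the revenue is finite and
    no utility is [-oo], so some utility is [+oo]. *)
Lemma nash_welfare_infinite M : nash_solution P V mu M -> welfare P V M = +oo.
Proof.
move=> [MfrakM best _].
have Pf := posted_frakM n_gt0 iidV Vsupp p.
have [_ _ pP _ _] := (frakMP Vsupp _).1 Pf.
have [fM aM pM _ _] := (frakMP Vsupp _).1 MfrakM.
have objP : nash_objective P V (posted n p) = +oo.
  rewrite /nash_objective (revenueE pP).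
  have -> : \prod_(i < n) buyer_util P V (posted n p) i = +oo.
    under eq_bigr do rewrite posted_util_infinite.
    case: n n_gt0 => // m _; elim: m => [|m IH]; first by rewrite big_ord1.
    by rewrite big_ord_recr/= IH mulyy.
  rewrite gt0_muley// lte_fin; exact: (posted_rev_gt0 n_gt0 iidV p0 pmu).
have : nash_objective P V M = +oo.
  by apply/eqP; rewrite -leye_eq -objP; exact: best.
have Va0 i : 0 <= \int[P]_w (V i w * alloc M i (prof V w))%:E.
  have mVa : measurable_fun setT (fun w => (V i w * alloc M i (prof V w))%R).
    by have [_ a2 _] := aM; apply: measurable_funM => //; exact: srv_measurable (a2 i).
  rewrite (ae_eq_integral (fun w => `|V i w * alloc M i (prof V w)|%:E))//.
  - by apply: integral_ge0 => w _; rewrite lee_fin.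
  - exact/measurable_EFinP.
  - by apply/measurable_EFinP; exact: measurableT_comp.
  apply: filterS2 (Vge0 Vsupp supp_ge0) (prof_ae_supp Vsupp) => w v0 sw _.
  have /andP[a0 _] := feasible_le1 fM sw i.
  by rewrite ger0_norm// mulr_ge0//; exact: v0.
have [_ p2 _] := pM.
have uNoo i : buyer_util P V M i != -oo.
  rewrite /buyer_util espE//; move: (Va0 i).
  by case: (\int[P]_w _)%E.
rewrite /nash_objective /welfare (revenueE pM) => obj.
have [/existsP[i /eqP ui]|none] := boolP [exists i, buyer_util P V M i == +oo].
  have -> : \sum_(i < n) buyer_util P V M i = +oo.
    by apply/eqP; rewrite esum_eqy//; apply/existsP; exists i; rewrite ui /=.
  by [].
have : \prod_(i < n) buyer_util P V M i \is a fin_num.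
  apply: prode_fin_num => i _; rewrite fin_numE uNoo/=.
  by apply: contra none => /eqP ui; apply/existsP; exists i; rewrite ui.
by move=> /fineK e; rewrite -e -EFinM in obj.
Qed.

End InfiniteWelfare.

(** * Finite welfare *)

Section FiniteWelfare.
Context (R : realType) (d : measure_display) (Omega : measurableType d).
Context (P : probability Omega R) (n : nat) (V : 'I_n -> Omega -> R).
Context (mu : probability R R).
Hypothesis n_gt0 : (0 < n)%N.
Hypothesis iidV : iid_values P V mu.
Hypothesis supp_ge0 : forall t, supp mu t -> 0 <= t.
Hypothesis sT : summable_rv P (fun w => top_value (prof V w)).

Let mV i : measurable_fun setT (V i). Proof. by case: iidV. Qed.
Let lawV i (B : set R) : measurable B -> P (V i @^-1` B) = mu B.
Proof. by case: iidV => _ + _; exact. Qed.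
Let Vsupp := values_supp iidV.
Let Vpos := Vge0 Vsupp supp_ge0.

Lemma value_srv i : summable_rv P (V i).
Proof.
apply: (srv_dominated (mV i) sT); apply: filterS Vpos => w v0.
by rewrite ger0_norm//; exact: (top_value_ge (prof V w) i).
Qed.

Definition mix (l : R) (M M' : mechanism R n) : mechanism R n :=
  Mechanism (fun i v => (1 - l) * alloc M i v + l * alloc M' i v)
            (fun i v => (1 - l) * pay M i v + l * pay M' i v).

Lemma mix_frakM l M M' : 0 <= l <= 1 ->
  in_frakM P V mu M -> in_frakM P V mu M' -> in_frakM P V mu (mix l M M').
Proof.
move=> /andP[l0 l1] /(frakMP Vsupp _)[fM aM pM bM iM] /(frakMP Vsupp _)[fM' aM' pM' bM' iM'].
have l1' : 0 <= 1 - l by rewrite subr_ge0.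
have iE (f g : 'I_n -> ('I_n -> R) -> R) i t : supp mu t ->
    admissible P V mu f -> admissible P V mu g ->
    interim P V (fun i v => (1 - l) * f i v + l * g i v) i t =
    (1 - l) * interim P V f i t + l * interim P V g i t.
  move=> st af ag; rewrite (interimD _ st (adm_scale _ af) (adm_scale _ ag)).
  by rewrite (interimZ _ _ st af) (interimZ _ _ st ag).
apply/(frakMP Vsupp _); split.
- move=> v sv; have [a0 a1] := fM v sv; have [b0 b1] := fM' v sv; split=> [i|].
    by rewrite addr_ge0// mulr_ge0.
  rewrite big_split/= -!mulr_sumr.
  have := ler_wpM2l l1' a1; have := ler_wpM2l l0 b1; lra.
- by apply: adm_add; exact: adm_scale.
- by apply: adm_add; exact: adm_scale.
- move=> i t t' st st'; rewrite /= !iE//.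
  have := ler_wpM2l l1' (bM i t t' st st'); have := ler_wpM2l l0 (bM' i t t' st st'); lra.
- move=> i t st; rewrite /= !iE//.
  have := mulr_ge0 l1' (iM i t st); have := mulr_ge0 l0 (iM' i t st); lra.
Qed.

Lemma exante_mix l (f g : 'I_n -> ('I_n -> R) -> R) i :
  admissible P V mu f -> admissible P V mu g ->
  exante P V (fun i v => (1 - l) * f i v + l * g i v) i =
  (1 - l) * exante P V f i + l * exante P V g i.
Proof.
move=> af ag; rewrite (exanteD _ (adm_scale _ af) (adm_scale _ ag)).
by rewrite (exanteZ _ _ af) (exanteZ _ _ ag).
Qed.

Lemma gain_mix l M M' i : in_frakM P V mu M -> in_frakM P V mu M' ->
  buyer_gain P V (mix l M M') i = (1 - l) * buyer_gain P V M i + l * buyer_gain P V M' i.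
Proof.
move=> fM fM'.
have aM := surplus_frakM mV Vsupp Vpos value_srv fM.
have aM' := surplus_frakM mV Vsupp Vpos value_srv fM'.
rewrite /buyer_gain -(exante_mix l i aM aM').
by apply: eq_esp => w; rewrite /surplus /=; ring.
Qed.

Lemma rev_mix l M M' : in_frakM P V mu M -> in_frakM P V mu M' ->
  seller_rev P V (mix l M M') = (1 - l) * seller_rev P V M + l * seller_rev P V M'.
Proof.
move=> /(frakMP Vsupp _)[_ _ pM _ _] /(frakMP Vsupp _)[_ _ pM' _ _].
rewrite /seller_rev !mulr_sumr -big_split/=; apply: eq_bigr => i _.
exact: exante_mix.
Qed.

Lemma welfareE M : in_frakM P V mu M ->
  welfare P V M = (seller_rev P V M + \sum_i buyer_gain P V M i)%:E.
Proof.
move=> /(frakMP Vsupp _)[fM aM pM _ _]; rewrite /welfare (revenueE pM) EFinD.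
congr (_ + _)%E; rewrite -sumEFin; apply: eq_bigr => i _.
by rewrite (buyer_utilE mV Vsupp Vpos value_srv _ fM aM pM).
Qed.

Lemma optE : opt P V = (esp P (fun w => top_value (prof V w)))%:E.
Proof. exact: (espE sT). Qed.

Context (vL : R) (Hs : nat -> R).
Hypothesis supp_vL : supp mu vL.
Hypothesis supp_itv : forall s t, supp mu t -> vL <= s -> s <= t -> supp mu s.
Hypothesis supp_ge : forall t, supp mu t -> vL <= t.
Hypothesis supp_Hs : forall m, supp mu (Hs m).
Hypothesis Hs_exhaust : forall x, supp mu x -> \forall m \near \oo, x <= Hs m.

(** With the posted price as reference mechanism, revenue and gains at [M] are positive. The
    first-order condition against the Groves mechanism, whose gains are [T / n], bounds the sum of
    the gains, and the positive revenue is added. *)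
Lemma nash_welfare_finite M : nash_solution P V mu M ->
  (n%:R - 1) / n%:R * esp P (fun w => top_value (prof V w)) <=
  seller_rev P V M + \sum_i buyer_gain P V M i.
Proof.
move=> [fM best _]; set T := esp P _.
have T0 : 0 <= T.
  by rewrite -(esp_cst P 0); apply: le_esp => // [|w]; [exact: srv_cst|exact: top_value_ge0].
have W := welfare_ge0 mV Vsupp Vpos value_srv fM.
have [[p [p0 pmu]]|none] := pselect (exists p, 0 < p /\ (0 < mu [set x | (2 * p < x)%R])%E); last first.
  (* If no positive threshold is exceeded with positive probability, all values are almost surely at
     most 0. *)
  suff -> : T = 0 by rewrite mulr0.
  have v0 : {ae P, forall w, forall i, V i w <= 0}.
    apply: (ae_values_le0 iidV) => p p0; apply/eqP; rewrite eq_le measure_ge0 andbT.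
    by rewrite leNgt; apply/negP => pmu; apply: none; exists p.
  have : T <= esp P (fun=> 0).
    apply: ae_le_esp => //; first exact: srv_cst.
    by apply: filterS v0 => w vw; exact: top_value_le.
  by rewrite esp_cst => T0'; apply/eqP; rewrite eq_le T0' T0.
have rev1 := posted_rev_gt0 n_gt0 iidV p0 pmu.
have gain1 i := posted_util_gt0 n_gt0 iidV Vsupp supp_ge0 p0 pmu i value_srv.
have fP := posted_frakM n_gt0 iidV Vsupp p.
have [rM gM] := nash_positive n_gt0 mV lawV Vsupp Vpos value_srv supp_vL supp_itv
  supp_ge supp_Hs Hs_exhaust fP rev1 gain1 fM best.
have fG := groves_frakM n_gt0 iidV Vsupp supp_ge0 sT.
have nR : 0 < n%:R :> R by rewrite ltr0n.
have := @nash_foc R n _ (T / n%:R) _ n_gt0 rM (divr_ge0 T0 (ltW nR)) gM.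
have step l : 0 <= l <= 1 ->
    (1 - l) * seller_rev P V M * \prod_i ((1 - l) * buyer_gain P V M i + l * (T / n%:R)) <=
    seller_rev P V M * \prod_i buyer_gain P V M i.
  move=> l01; have fX := mix_frakM l01 fM fG.
  have := best _ fX; rewrite !(nash_objE mV Vsupp Vpos value_srv)// lee_fin.
  rewrite rev_mix// (groves_rev n_gt0 iidV Vsupp supp_ge0 sT) mulr0 addr0.
  apply: le_trans; rewrite le_eqVlt; apply/orP; left; apply/eqP; congr (_ * _).
  by apply: eq_bigr => i _; rewrite gain_mix// groves_gain.
move=> /(_ step); rewrite mulrCA mulrA; lra.
Qed.

End FiniteWelfare.

(** * The welfare bound, by cases on whether Opt is finite *)

Theorem theorem5p2 (R : realType) (d : measure_display) (Omega : measurableType d)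
  (P : probability Omega R) (n : nat) (V : 'I_n -> Omega -> R)
  (mu : probability R R) (vL : R) (top : \bar R) (M : mechanism R n) :
  (1 <= n)%N ->
  standing_assumptions mu vL top ->
  regular mu vL top ->
  antiMHR mu vL top ->
  iid_values P V mu ->
  nash_solution P V mu M ->
  (((n%:R - 1) / n%:R)%:E * opt P V <= welfare P V M)%E.
Proof.
move=> n0 [[vL0 topN] suppE _ _ [p0 [sp0 _]]] _ _ iidV nash.
have suppP t : supp mu t <-> vL <= t /\ (t%:E <= top)%E by rewrite suppE.
have supp_ge t : supp mu t -> vL <= t by move=> /suppP[].
have supp_ge0 t : supp mu t -> 0 <= t by move=> /supp_ge; exact: le_trans.
have supp_itv s t : supp mu t -> vL <= s -> s <= t -> supp mu s.
  by move=> /suppP[_ tt] vs st; apply/suppP; split=> //; apply: le_trans tt; rewrite lee_fin.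
(* The revenue-maximizing price [p0] shows that the support is nonempty, so it contains its lower
   end. *)
have supp_vL : supp mu vL := supp_itv _ _ sp0 (lexx _) (supp_ge _ sp0).
have [fM _ _] := nash.
have T0 w : 0 <= top_value (prof V w) := top_value_ge0 _.
have mT : measurable_fun setT (fun w => top_value (prof V w)).
  by apply: measurable_top_value => j; case: iidV => mV _ _; exact: mV.
have [optfin|optoo] := boolP (opt P V < +oo)%E; last first.
  have {}optoo : opt P V = +oo%E by apply/eqP; rewrite -leye_eq leNgt.
  have [[p [pp pmu]]|none] := pselect (exists p, 0 < p /\ (0 < mu [set x | (2 * p < x)%R])%E).
    by rewrite (nash_welfare_infinite n0 iidV supp_ge0 pp pmu optoo nash) leey.
  have v0 : {ae P, forall w, forall i, V i w <= 0}.
    apply: (ae_values_le0 iidV) => p pp; apply/eqP; rewrite eq_le measure_ge0 andbT.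
    by rewrite leNgt; apply/negP => pmu; apply: none; exists p.
  suff : opt P V = 0%E by rewrite optoo.
  rewrite -[RHS](integral0 P setT); apply: ae_eq_integral => //; first exact/measurable_EFinP.
  apply: filterS v0 => w vw _; congr (_%:E); apply/eqP; rewrite eq_le; apply/andP; split.
    by apply: top_value_le.
  exact: T0.
have sT : summable_rv P (fun w => top_value (prof V w)).
  apply/integrableP; split; first exact/measurable_EFinP.
  by under eq_integral do rewrite /= ger0_norm//.
rewrite (optE sT) (welfareE iidV supp_ge0 sT fM) -EFinM lee_fin.
(* Support points that climb from [vL] in unit steps and stay at a finite top once it is passed. *)
pose Hs (m : nat) := if `[< supp mu (vL + m%:R) >] then vL + m%:R else fine top.
have top_real m : ~ supp mu (vL + m%:R) -> top = (fine top)%:E /\ fine top < vL + m%:R.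
  move=> nm; have : ~~ ((vL + m%:R)%:E <= top)%E.
    by apply/negP => h; apply: nm; apply/suppP; split=> //; rewrite lerDl.
  by case: (top) topN => [x| |]//= _; rewrite -ltNge ?lte_fin// ltNge leey.
have supp_Hs m : supp mu (Hs m).
  rewrite /Hs; case: asboolP => // /top_real[tE _].
  by apply/suppP; rewrite -tE; split=> //; move/suppP: supp_vL => [_]; rewrite tE lee_fin.
apply: (nash_welfare_finite n0 iidV supp_ge0 sT supp_vL supp_itv supp_ge supp_Hs _ nash).
move=> x sx; exists (Num.truncn (x - vL)).+1 => // m /= xm.
rewrite /Hs; case: asboolP => [_|/top_real[tE _]]; last first.
  by move/suppP: sx => [_]; rewrite tE lee_fin.
by rewrite -lerBlDl; apply: ltW; apply: lt_le_trans (truncnS_gt _) _; rewrite ler_nat.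
Qed.
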